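(* Let $\mathcal{B}_0$ be a $C^*$-algebra, $(\lambda_t)_{t\ge0}$ a semigroup of injective endomorphisms of $\mathcal{B}_0$ and $\psi$ a $(\lambda_t)$-invariant state on $\mathcal{B}_0$. Let $\psi_{-\infty}$ be the inductive limit state on the inductive limit $C^*$-algebra $\mathcal{B}_{-\infty}$, and let $(\mathcal{A}_0,\tau_t,\psi_0)$ be the reduced Markov semigroup on the support projection of $\psi$ (defined in the context). Then $\psi_{-\infty}$ is a pure state if $\psi_0(\tau_t(x)\tau_t(y))\to\psi_0(x)\psi_0(y)$ as $t\to\infty$ for all $x,y\in\mathcal{A}_0$.
   Context: Time $t\ge 0$ is in $\mathbb{R}_+$ or $\mathbb{Z}_+$, and $\mathbb{T}$ is $\mathbb{R}$ or $\mathbb{Z}$ correspondingly. Let $\mathcal{B}_{-\infty}$ be the $C^*$-inductive limit of $\mathcal{B}_0\xrightarrow{\lambda_t}\mathcal{B}_0\xrightarrow{\lambda_t}\cdots$: a $C^*$-algebra with a group of automorphisms $(\lambda_t)_{t\in\mathbb{T}}$, an isomorphism $i_0$ of $\mathcal{B}_0$ onto a subalgebra $\mathcal{B}_{[0}$ with $\lambda_t\circ i_0=i_0\circ\lambda_t$ for $t\ge0$, and subalgebras $\mathcal{B}_{[t}=\lambda_t(\mathcal{B}_{[0})$, $t\in\mathbb{T}$, decreasing in $t$ and with $\bigcup_t\mathcal{B}_{[t}$ norm dense. $\psi_{-\infty}$ is the unique $(\lambda_t)$-invariant state of $\mathcal{B}_{-\infty}$ with $\psi_{-\infty}\circ i_0=\psi$.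 Let $\pi_0$ be the GNS representation of $(\mathcal{B}_0,\psi)$; $(\lambda_t)_{t\ge 0}$ also denotes the normal extension to endomorphisms of $\pi_0(\mathcal{B}_0)''$, and $\psi$ the GNS vector state on $\pi_0(\mathcal{B}_0)''$. $P$ is the support projection of $\psi$ in $\pi_0(\mathcal{B}_0)''$, $\mathcal{A}_0=P\pi_0(\mathcal{B}_0)''P$, $\tau_t(x)=P\lambda_t(PxP)P$ and $\psi_0(x)=\psi(PxP)$ for $x\in\mathcal{A}_0$, $t\ge0$. *)

(* Defs.v *)
From HB Require Import structures.
From mathcomp Require Import all_boot all_order all_algebra.
From mathcomp Require Import sesquilinear.
From mathcomp Require Import complex.
From mathcomp Require Import all_classical all_reals.
From mathcomp Require Import topology normedtype sequences.

Set Implicit Arguments.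
Unset Strict Implicit.
Unset Printing Implicit Defensive.

Import Order.TTheory GRing.Theory Num.Theory.
Import numFieldNormedType.Exports.

Local Open Scope classical_set_scope.
Local Open Scope complex_scope.
Local Open Scope ring_scope.

(* Not necessarily unital C*-algebras; the norm, like every norm on a module
   over R[i], takes its (nonnegative real) values in R[i]. *)
HB.mixin Record isCStarAlgebra (R : realType) A
    & CompleteNormedModule R[i] A := {
  amul : A -> A -> A ;
  star : A -> A ;
  amulA : associative amul ;
  amul_linearl : forall b, linear (amul^~ b) ;
  amul_linearr : forall a, linear (amul a) ;
  star_antilinear : forall (c : R[i]) a b, star (c *: a + b) = c^* *: star a + star b ;
  starM : forall a b, star (amul a b) = amul (star b) (star a) ;
  starK : involutive star ;
  norm_amul : forall a b, `|amul a b| <= `|a| * `|b| ;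
  cstar_identity : forall a, `|amul (star a) a| = `|a| ^+ 2
}.

#[short(type="cstarAlgType")]
HB.structure Definition CStarAlgebra (R : realType) :=
  {A of isCStarAlgebra R A & CompleteNormedModule R[i] A}.

(* The inner product is linear in its first argument, as {dot _ for conjC}. *)
HB.mixin Record isHilbertSpace (R : realType) H
    & CompleteNormedModule R[i] H := {
  inner : {dot H for (@Num.conj R[i])} ;
  inner_norm : forall x : H, inner x x = `|x| ^+ 2
}.

#[short(type="hilbertType")]
HB.structure Definition HilbertSpace (R : realType) :=
  {H of isHilbertSpace R H & CompleteNormedModule R[i] H}.

Variant time_kind := continuous_time | discrete_time.

Definition time (R : realType) (k : time_kind) : realDomainType :=
  match k with continuous_time => R | discrete_time => int end.

(* The filter of t --> +oo, also for T = int. *)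
Definition time_infty (T : realDomainType) : set_system T :=
  [set A | exists t0 : T, forall t, t0 <= t -> A t].
Arguments time_infty : clear implicits.

Section CStarAlgebras.
Variable R : realType.
Implicit Types A B : cstarAlgType R.

Definition star_hom A B (f : A -> B) : Prop :=
  [/\ linear f,
      forall a b, f (amul a b) = amul (f a) (f b) &
      forall a, f (star a) = star (f a)].

Definition state A (phi : A -> R[i]) : Prop :=
  [/\ scalar phi,
      forall a, 0 <= phi (amul (star a) a),
      forall a, `|phi a| <= `|a| &
      forall c : R[i], 0 <= c -> (forall a, `|phi a| <= c * `|a|) -> 1 <= c].

Definition pure_state A (phi : A -> R[i]) : Prop :=
  state phi /\
  forall (s : R) (phi1 phi2 : A -> R[i]), 0 < s < 1 ->
    state phi1 -> state phi2 ->
    (forall a, phi a = s%:C * phi1 a + (1 - s)%:C * phi2 a) ->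
    phi1 =1 phi /\ phi2 =1 phi.

(* Only the values of lam at t >= 0 are relevant. *)
Definition injective_endomorphism_semigroup (T : realDomainType) B
    (lam : T -> B -> B) : Prop :=
  [/\ forall t, 0 <= t -> star_hom (lam t) /\ injective (lam t),
      forall b, lam 0 b = b &
      forall s t, 0 <= s -> 0 <= t -> forall b, lam (s + t) b = lam s (lam t b)].

Definition automorphism_group (T : realDomainType) A
    (lam : T -> A -> A) : Prop :=
  [/\ forall t, star_hom (lam t),
      forall a, lam 0 a = a &
      forall s t a, lam (s + t) a = lam s (lam t a)].

Definition tail_algebra (T : realDomainType) A B (i0 : B -> A)
    (laminf : T -> A -> A) (t : T) : set A :=
  laminf t @` range i0.

(* The inductive limit of B --lam t--> B --lam t--> ..., determined up to
   isomorphism by these properties: the canonical map of the copy of B with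
   index -t (t >= 0) is laminf (-t) \o i0. *)
Definition inductive_limit (T : realDomainType) A B (lam : T -> B -> B)
    (laminf : T -> A -> A) (i0 : B -> A) : Prop :=
  [/\ automorphism_group laminf,
      star_hom i0 /\ injective i0,
      forall t, 0 <= t -> forall b, laminf t (i0 b) = i0 (lam t b) &
      dense (\bigcup_(t in setT) tail_algebra i0 laminf t)].

Lemma tail_algebra_decreasing (T : realDomainType) A B (lam : T -> B -> B)
    (laminf : T -> A -> A) (i0 : B -> A) (s t : T) :
  inductive_limit lam laminf i0 -> s <= t ->
  tail_algebra i0 laminf t `<=` tail_algebra i0 laminf s.
Proof.
move=> [[_ _ lamD] _ i0lam _] st _ [_ [b _ <-] <-].
exists (i0 (lam (t - s) b)); first by exists (lam (t - s) b).
by rewrite -i0lam ?subr_ge0// -lamD addrC subrK.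
Qed.

End CStarAlgebras.

Section Operators.
Variables (R : realType) (H : hilbertType R).
Implicit Types (X Y P Q : H -> H) (M : set (H -> H)) (Omega : H).

Definition bounded_op X : Prop := linear X /\ continuous X.

Definition adjoint X Y : Prop := forall x y, inner (X x) y = inner x (Y y).

Definition commutant M : set (H -> H) :=
  [set X | bounded_op X /\ forall Y, M Y -> X \o Y = Y \o X].

Definition bicommutant M : set (H -> H) := commutant (commutant M).

Definition vector_state Omega X : R[i] := inner (X Omega) Omega.

Definition is_projection P : Prop :=
  [/\ bounded_op P, P \o P = P & adjoint P P].

(* The smallest projection in M on which the vector state is 1;
   Q \o P = P is P <= Q. *)
Definition support_projection M Omega P : Prop :=
  [/\ M P, is_projection P, vector_state Omega P = 1 &
      forall Q, M Q -> is_projection Q -> vector_state Omega Q = 1 ->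
        Q \o P = P].

Definition square_summable (xi : nat -> H) : Prop :=
  cvgn (series (fun n => `|xi n| ^+ 2 : R[i]^o)).

(* X |-> \sum_n <X xi_n, eta_n>; these functionals, for square-summable xi and
   eta, generate the sigma-weak topology. *)
Definition sigma_weak_functional (xi eta : nat -> H) X : R[i]^o :=
  limn (series (fun n => inner (X (xi n)) (eta n) : R[i]^o)).

Definition sigma_weak_cvg (F : set_system (H -> H)) X : Prop :=
  forall xi eta, square_summable xi -> square_summable eta ->
    sigma_weak_functional xi eta Y @[Y --> F] --> sigma_weak_functional xi eta X.

(* Sigma-weak continuity of L on M. *)
Definition normal_on M (L : (H -> H) -> (H -> H)) : Prop :=
  forall (F : set_system (H -> H)) X, ProperFilter F -> F M -> M X ->
    sigma_weak_cvg F X -> sigma_weak_cvg (L @ F) (L X).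

Definition normal_endomorphism M (L : (H -> H) -> (H -> H)) : Prop :=
  [/\ forall X, M X -> M (L X),
      forall (c : R[i]) X Y, M X -> M Y -> L (c *: X + Y) = c *: L X + L Y,
      forall X Y, M X -> M Y -> L (X \o Y) = L X \o L Y,
      forall X Y, M X -> M Y -> adjoint X Y -> adjoint (L X) (L Y) &
      normal_on M L].

Definition corner M P : set (H -> H) := [set P \o X \o P | X in M].

Definition reduced_map P (L : (H -> H) -> (H -> H)) X : H -> H :=
  P \o L (P \o X \o P) \o P.

Definition reduced_state Omega P X : R[i] := vector_state Omega (P \o X \o P).

End Operators.

(* The GNS triple (H, pi, Omega) of phi, determined up to unitary equivalence. *)
Definition gns_representation (R : realType) (B : cstarAlgType R)
    (phi : B -> R[i]) (H : hilbertType R) (pi : B -> H -> H) (Omega : H) : Prop :=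
  [/\ (forall b, bounded_op (pi b)) /\ linear pi,
      forall a b, pi (amul a b) = pi a \o pi b,
      forall a, adjoint (pi a) (pi (star a)),
      forall b, phi b = vector_state Omega (pi b) &
      dense (range (fun b => pi b Omega))].

(* Main.v *)
Require Import Defs.
From HB Require Import structures.
From mathcomp Require Import all_boot all_order all_algebra.
From mathcomp Require Import sesquilinear complex.
From mathcomp Require Import all_classical all_reals topology normedtype sequences.
From mathcomp Require Import ring lra.

Set Implicit Arguments.
Unset Strict Implicit.
Unset Printing Implicit Defensive.

Import Order.TTheory GRing.Theory Num.Theory.
Import numFieldNormedType.Exports.

Local Open Scope classical_set_scope.
Local Open Scope complex_scope.
Local Open Scope ring_scope.

(* Suppose [psiinf = s phi1 + (1 - s) phi2]. For [t >= 0] the functional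
   [s phi1 \o laminf (- t) \o i0] on [B0] is dominated by [psi], so it has a
   Radon-Nikodym derivative [S] in the commutant of [pi0 B0]; as [S] commutes with
   the support projection [P] and [P Omega = Omega],
     s phi1 (i0 c) = <P pi0 (lam t c) Omega, S Omega>
   for products [c = a^* b]. Normality of [Lam t] gives [P <= Lam t P], so that the
   mixing hypothesis for [x = P pi0 (c^* ) P] and [y = P pi0 c P] reads
   |P pi0 (lam t c) Omega|^2 -> |psi c|^2, that is, P pi0 (lam t c) Omega ->
   (psi c) Omega. As [|S Omega| <= 1], letting [t] tend to infinity shows that [phi1]
   and [psiinf] are proportional on such products, likewise on every
   [laminf u (i0 B0)], hence everywhere. Both are states, so they are equal. *)

(** * Positive forms and the Riesz representation theorem *)

(** Three obstacles shape the proof. No algebra here need have a unit, so approximate units take its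
    place: they give |psi c|^2 <= psi (c^* c), hence |Omega| <= 1, and they make the products a^* b,
    which are what a Radon-Nikodym derivative describes, total in the algebra. Next, invariance of
    the vector state under [Lam t] is given only on [pi0 B0]; carrying it over to [P] requires
    elements of [pi0 B0] that converge to [P] sigma-weakly, whence the density form of the
    bicommutant theorem on square-summable sequences. Finally, [S] depends on [t], so that <Omega, S
    Omega> has no evident limit; the identities for two products at the same [t] are therefore
    cross-multiplied, which eliminates this number. Only proportionality survives, and the
    normalization of states supplies the factor 1. *)

Section ComplexNumbers.
Variable R : realType.
Implicit Types (c d : R[i]) (r : R).

Lemma ReD c d : complex.Re (c + d) = complex.Re c + complex.Re d.
Proof. by case: c d => [? ?] [? ?]. Qed.

Lemma ReB c d : complex.Re (c - d) = complex.Re c - complex.Re d.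
Proof. by case: c d => [? ?] [? ?]. Qed.

Lemma Re_conj c : complex.Re c^* = complex.Re c.
Proof. by case: c. Qed.

Lemma ReZ r c : complex.Re (r%:C * c) = r * complex.Re c.
Proof. by case: c => a b /=; rewrite mul0r subr0. Qed.

Lemma ReNi c : complex.Re (- 'i%C * c) = complex.Im c.
Proof. by case: c => a b /=; ring. Qed.

Lemma conj_rC r : (r%:C)^* = r%:C :> R[i].
Proof. exact: conjc_real. Qed.

Lemma ge0_ReE c : 0 <= c -> c = (complex.Re c)%:C.
Proof. by move=> c0; rewrite RRe_real// ger0_real. Qed.

Lemma ge0_Re c : 0 <= c -> 0 <= complex.Re c.
Proof. by move=> c0; rewrite -ler0c -ge0_ReE. Qed.

Lemma rC_gt0 r : (0 < r%:C :> R[i]) = (0 < r).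
Proof. by rewrite -ltcR rmorph0. Qed.

Definition sqmod c : R := complex.Re c ^+ 2 + complex.Im c ^+ 2.

Lemma sqmodE c : `|c| ^+ 2 = (sqmod c)%:C.
Proof. by rewrite /sqmod add_Re2_Im2. Qed.

Lemma conj_mul c : c^* * c = (sqmod c)%:C.
Proof. by rewrite -sqmodE mulrC -normCK. Qed.

Lemma sqmod_ge0 c : 0 <= sqmod c.
Proof. by rewrite addr_ge0// sqr_ge0. Qed.

Lemma sqmod_eq0 c : sqmod c = 0 -> c = 0.
Proof.
move=> c0; apply/eqP; rewrite -normr_eq0 -sqrf_eq0 sqmodE c0.
by rewrite eqxx.
Qed.

Lemma sqmodM c d : sqmod (c * d) = sqmod c * sqmod d.
Proof. by case: c d => [a b] [x y]; rewrite /sqmod /=; ring. Qed.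

Lemma sqmodJ c : sqmod c^* = sqmod c.
Proof. by case: c => a b; rewrite /sqmod /= sqrrN. Qed.

Lemma sqmodR r : sqmod r%:C = r ^+ 2.
Proof. by rewrite /sqmod /= expr0n addr0. Qed.

Lemma sqmodD_le c d : sqmod (c + d) <= 2 * sqmod c + 2 * sqmod d.
Proof.
case: c d => [a b] [x y]; rewrite /sqmod /=.
have := sqr_ge0 (a - x); have := sqr_ge0 (b - y); nra.
Qed.

Lemma Re_le_sqmod c : complex.Re c ^+ 2 <= sqmod c.
Proof. by rewrite lerDl sqr_ge0. Qed.

Lemma discr_le (a b c : R) :
  (forall t, 0 <= a * t ^+ 2 + 2 * b * t + c) -> b ^+ 2 <= a * c.
Proof.
move=> h; have c0 : 0 <= c by have := h 0; rewrite expr0n/= !mulr0 !add0r.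
have [a0|a0] := ltrP 0 a.
  have := h (- b / a); rewrite -(ler_pM2l a0) mulr0.
  have -> : a * (a * (- b / a) ^+ 2 + 2 * b * (- b / a) + c) = a * c - b ^+ 2.
    by field; rewrite gt_eqF.
  by rewrite subr_ge0.
have [b0|b0] := eqVneq b 0.
  rewrite b0 expr0n/=; move: a0; rewrite le_eqVlt => /predU1P[->|a0].
    by rewrite mul0r.
  (* Here [b = 0] and [a < 0]: this argument is large enough for [a t^2] to fall below [- c]. *)
  exfalso; have := h (c / (- a) + 1).
  have na : 0 < - a by rewrite oppr_gt0.
  rewrite b0 mulr0 mul0r addr0; apply/negP; rewrite -ltNge.
  have -> : a * (c / - a + 1) ^+ 2 + c = - (c ^+ 2 / (- a) + c + (- a)).
    by field; rewrite lt_eqF.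
  rewrite oppr_lt0 -addrA; apply: ltr_wpDl; first by rewrite divr_ge0 ?sqr_ge0// ltW.
  by apply: ltr_wpDl.
(* Now [a <= 0] and [b] is nonzero: this argument makes the affine part [2 b t + c] equal to -1, and
   the quadratic part cannot compensate. *)
exfalso; have := h (- (c + 1) / (2 * b)); apply/negP; rewrite -ltNge.
have -> : a * (- (c + 1) / (2 * b)) ^+ 2 + 2 * b * (- (c + 1) / (2 * b)) + c =
  a * (- (c + 1) / (2 * b)) ^+ 2 - 1.
  by field.
have : a * (- (c + 1) / (2 * b)) ^+ 2 <= 0.
  by apply: mulr_le0_ge0 => //; exact: sqr_ge0.
lra.
Qed.

Lemma le_eps (a b : R) : (forall e, 0 < e -> a <= b + e) -> a <= b.
Proof. by move=> h; apply/ler_addgt0Pr => e /h. Qed.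

Lemma le0_eps (a K : R) : 0 <= K -> (forall e, 0 < e -> a <= K * e) -> a <= 0.
Proof.
move=> K0 h; apply: le_eps => e e0; rewrite add0r.
have K1 : 0 < K + 1 by rewrite ltr_wpDl.
apply: le_trans (h (e / (K + 1)) _) _; first by rewrite divr_gt0.
by rewrite mulrA ler_pdivrMr// [_ * e]mulrC ler_pM2l// lerDl.
Qed.

End ComplexNumbers.

Section LinearMaps.
Variables (R : realType) (U V : lmodType R[i]) (f : U -> V).
Hypothesis lf : linear f.

Lemma lin0 : f 0 = 0.
Proof.
have := lf 1 0 0; rewrite !scale1r addr0 => /(congr1 (fun x => x - f 0)).
by rewrite subrr addrK.
Qed.

Lemma linD x y : f (x + y) = f x + f y.
Proof. by have := lf 1 x y; rewrite !scale1r. Qed.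

Lemma linZ a x : f (a *: x) = a *: f x.
Proof. by have := lf a x 0; rewrite !addr0 lin0 addr0. Qed.

Lemma linN x : f (- x) = - f x.
Proof. by rewrite -scaleN1r linZ scaleN1r. Qed.

Lemma linB x y : f (x - y) = f x - f y.
Proof. by rewrite linD linN. Qed.

Lemma lin_sum (I : Type) (r : seq I) (P : pred I) F :
  f (\sum_(i <- r | P i) F i) = \sum_(i <- r | P i) f (F i).
Proof. exact: (big_morph f linD lin0). Qed.

End LinearMaps.

Section LinearFunctionals.
Variables (R : realType) (U : lmodType R[i]) (f : U -> R[i]).
Hypothesis lf : scalar f.

Let lf' : linear (f : U -> R[i]^o). Proof. exact: lf. Qed.

Lemma scal0 : f 0 = 0. Proof. exact: (lin0 lf'). Qed.
Lemma scalD x y : f (x + y) = f x + f y. Proof. exact: (linD lf'). Qed.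
Lemma scalB x y : f (x - y) = f x - f y. Proof. exact: (linB lf'). Qed.
Lemma scalN x : f (- x) = - f x. Proof. exact: (linN lf'). Qed.
Lemma scalZ a x : f (a *: x) = a * f x. Proof. exact: (linZ lf'). Qed.

End LinearFunctionals.

Section Forms.
Variables (R : realType) (V : lmodType R[i]) (q : V -> V -> R[i]).

Definition positive_form : Prop :=
  [/\ forall y, scalar (q^~ y), forall x y, q y x = (q x y)^* &
      forall x, 0 <= q x x].

Definition nsq x : R := complex.Re (q x x).

(** Phrased with sequences and [nsq] only, so that it also applies to [l2], which is given no
    topology. *)
Definition form_complete : Prop := forall u : nat -> V,
  (forall e : R, 0 < e -> exists N, forall m n, (N <= m)%N -> (N <= n)%N ->
    nsq (u m - u n) <= e) ->
  exists l, forall e : R, 0 < e -> exists N, forall n, (N <= n)%N ->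
    nsq (u n - l) <= e.

Hypothesis qP : positive_form.

Let linq y : scalar (q^~ y). Proof. by case: qP => + _ _; exact. Qed.

Lemma formC x y : q y x = (q x y)^*. Proof. by case: qP => _ + _; exact. Qed.

Lemma formDl x y z : q (x + y) z = q x z + q y z.
Proof. exact: (scalD (linq z)). Qed.

Lemma formZl a x z : q (a *: x) z = a * q x z.
Proof. exact: (scalZ (linq z)). Qed.

Lemma formNl x z : q (- x) z = - q x z.
Proof. exact: (scalN (linq z)). Qed.

Lemma formBl x y z : q (x - y) z = q x z - q y z.
Proof. exact: (scalB (linq z)). Qed.

Lemma formDr z x y : q z (x + y) = q z x + q z y.
Proof. by rewrite formC formDl rmorphD/= -!formC. Qed.

Lemma formZr a z x : q z (a *: x) = a^* * q z x.
Proof. by rewrite formC formZl rmorphM/= -!formC. Qed.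

Lemma formNr z x : q z (- x) = - q z x.
Proof. by rewrite formC formNl rmorphN/= -!formC. Qed.

Lemma formBr z x y : q z (x - y) = q z x - q z y.
Proof. by rewrite formDr formNr. Qed.

Lemma form0l z : q 0 z = 0. Proof. exact: (scal0 (linq z)). Qed.

Lemma form0r z : q z 0 = 0. Proof. by rewrite formC form0l rmorph0. Qed.

Lemma nsqE x : q x x = (nsq x)%:C.
Proof. by case: qP => _ _ /(_ x); exact: ge0_ReE. Qed.

Lemma nsq_ge0 x : 0 <= nsq x.
Proof. by case: qP => _ _ /(_ x); exact: ge0_Re. Qed.

Lemma nsq0 : nsq 0 = 0. Proof. by rewrite /nsq form0l. Qed.

Lemma nsqD x y : nsq (x + y) = nsq x + nsq y + 2 * complex.Re (q x y).
Proof.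
rewrite /nsq formDl !formDr !ReD (formC x y) Re_conj; ring.
Qed.

Lemma nsqZ a x : nsq (a *: x) = sqmod a * nsq x.
Proof. by rewrite /nsq formZl formZr mulrA [_ * a^*]mulrC conj_mul ReZ. Qed.

Lemma nsqN x : nsq (- x) = nsq x.
Proof. by rewrite /nsq formNl formNr opprK. Qed.

Lemma nsqBC x y : nsq (x - y) = nsq (y - x).
Proof. by rewrite -nsqN opprB. Qed.

Lemma nsqB x y : nsq (x - y) = nsq x + nsq y - 2 * complex.Re (q x y).
Proof. by rewrite nsqD nsqN formNr; case: (q x y) => a b /=; rewrite mulrN. Qed.

Lemma nsqZR (r : R) x : nsq (r%:C *: x) = r ^+ 2 * nsq x.
Proof. by rewrite nsqZ sqmodR. Qed.

Lemma nsqD_le x y : nsq (x + y) <= 2 * nsq x + 2 * nsq y.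
Proof. by have := nsq_ge0 (x - y); rewrite nsqB nsqD; lra. Qed.

Lemma nsq_split x y z : nsq (x - z) <= 2 * nsq (x - y) + 2 * nsq (y - z).
Proof. by rewrite -(subrKA y) nsqD_le. Qed.

Lemma Re_form_sqr_le x y : complex.Re (q x y) ^+ 2 <= nsq x * nsq y.
Proof.
rewrite mulrC; apply: discr_le => t.
have := nsq_ge0 (x + t%:C *: y).
rewrite nsqD nsqZR formZr conj_rC ReZ; lra.
Qed.

Lemma Cauchy_Schwarz x y : sqmod (q x y) <= nsq x * nsq y.
Proof.
have [q0|q0] := eqVneq (sqmod (q x y)) 0.
  by rewrite q0 mulr_ge0// nsq_ge0.
have qp : 0 < sqmod (q x y) by rewrite lt0r q0 sqmod_ge0.
have := Re_form_sqr_le ((q x y)^* *: x) y.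
by rewrite formZl conj_mul nsqZ sqmodJ /= -mulrA expr2 ler_pM2l.
Qed.

(* Minimize [nsq (eta w) - 2 Re (f w)]: by the parallelogram law a minimizing
   sequence is Cauchy, and the limit represents [f]. *)
Lemma Riesz (W : lmodType R[i]) (eta : W -> V) (f : W -> R[i]) (K : R) :
  form_complete -> linear eta -> scalar f ->
  (forall w, 2 * complex.Re (f w) <= K + nsq (eta w)) ->
  exists v, [/\ forall w, f w = q (eta w) v,
    forall e : R, 0 < e -> exists w, nsq (v - eta w) <= e & nsq v <= K].
Proof.
move=> cV leta lf fK.
pose J w := nsq (eta w) - 2 * complex.Re (f w).
have JK w : - K <= J w by rewrite /J; have := fK w; lra.
pose m := inf (range J).
have hJ : has_inf (range J).
  by split; [exists (J 0), 0 | exists (- K) => _ [w _ <-]].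
have mJ w : m <= J w by apply: ge_inf; [case: hJ | exists w].
have Jm e : 0 < e -> exists w, J w <= m + e.
  by move=> /(inf_adherent)/(_ hJ)[_ [w _ <-]] /ltW; exists w.
have Jpar w w' : nsq (eta w - eta w') <= 2 * (J w - m) + 2 * (J w' - m).
  (* The midpoint of [w] and [w'] competes for the infimum. *)
  have := mJ (2^-1%:C *: (w + w')); rewrite /J.
  rewrite (linZ leta) (linD leta) nsqZR nsqD nsqB.
  rewrite (scalZ lf) (scalD lf) ReZ ReD; lra.
have /choice[u uJ] : forall n : nat, exists w, J w <= m + n.+1%:R^-1.
  by move=> n; apply: Jm; rewrite invr_gt0 ltr0n.
have small (e : R) : 0 < e -> exists N : nat, forall n, (N <= n)%N ->
    n.+1%:R^-1 <= e.
  move=> e0; exists (Num.truncn (e^-1)).+1 => n Nn.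
  rewrite invf_ple ?posrE//; apply: ltW; apply: lt_le_trans (truncnS_gt _) _.
  by rewrite ler_nat; apply: leq_trans Nn _.
have [v uv] : exists v, forall e : R, 0 < e -> exists N, forall n, (N <= n)%N ->
    nsq (eta (u n) - v) <= e.
  apply: (cV (eta \o u)) => e e0; have [|N hN] := small (e / 4); first by lra.
  have uN n : (N <= n)%N -> J (u n) <= m + e / 4.
    by move=> /hN he; apply: le_trans (uJ n) _; rewrite lerD2l.
  exists N => i j /uN ui /uN uj; apply: le_trans (Jpar _ _) _; lra.
have fE w : complex.Re (f w) = complex.Re (q (eta w) v).
  apply/eqP; rewrite -subr_eq0 -sqrf_eq0 eq_le sqr_ge0 andbT.
  apply: (@le0_eps _ _ (2 * nsq (eta w) + 2 * nsq (eta w))) => [|e e0].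
    by have := nsq_ge0 (eta w); lra.
  have [N hN] := uv _ e0; have [N' hN'] := small _ e0.
  pose n := maxn N N'.
  have un : J (u n) <= m + e.
    by apply: le_trans (uJ n) _; rewrite lerD2l hN'// leq_maxr.
  (* Since [u n] minimizes [J] up to [e], moving from it along [- t w] gives a quadratic in [t] that
     is nonnegative once [e] is added; this is its discriminant bound. *)
  have d1 : (complex.Re (f w) - complex.Re (q (eta w) (eta (u n)))) ^+ 2
      <= nsq (eta w) * e.
    apply: discr_le => t; have := mJ (u n - t%:C *: w); move: un.
    rewrite /J (linB leta) (linZ leta).
    rewrite nsqB nsqZR (scalB lf) (scalZ lf) formZr conj_rC ReB !ReZ.
    rewrite (formC (eta w) (eta (u n))) Re_conj; lra.
  have d2 : complex.Re (q (eta w) (eta (u n) - v)) ^+ 2 <= nsq (eta w) * e.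
    apply: le_trans (Re_form_sqr_le _ _) _.
    by rewrite ler_wpM2l ?nsq_ge0// hN// leq_maxl.
  move: d2; rewrite formBr ReB; set a := complex.Re (f w) in d1 *.
  set b := complex.Re (q _ (eta _)) in d1 *; set c := complex.Re (q _ _) => d2.
  have := sqr_ge0 ((a - b) - (b - c)); nra.
have vcl (e : R) : 0 < e -> exists w, nsq (v - eta w) <= e.
  by move=> /uv[N /(_ N (leqnn _))]; rewrite nsqBC; exists (u N).
exists v; split => //.
  move=> w; apply/eqP; rewrite eq_complex fE eqxx/=; apply/eqP.
  (* The imaginary part of [f w] is the real part at [- 'i w]. *)
  have := fE (- 'i%C *: w); rewrite (linZ leta) formZl (scalZ lf) /=.
  by rewrite !ReNi.
(* With [f w] replaced by [q (eta w) v], the hypothesis [fK] reads [nsq v <= K + nsq (v - eta w)],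
   and the last term is arbitrarily small. *)
apply: le_eps => e e0; have [w hw] := vcl _ e0.
have := fK w; rewrite fE; move: hw; rewrite nsqB (formC (eta w) v) Re_conj.
lra.
Qed.

End Forms.

(** Polarization: the diagonal values at [x + y] and at ['i x + y] are real, which ties [q x y] to
    the conjugate of [q y x]. *)
Lemma sesquilinear_hermitian (R : realType) (V : lmodType R[i]) (q : V -> V -> R[i]) :
  (forall y, scalar (q^~ y)) ->
  (forall c x y z, q x (c *: y + z) = c^* * q x y + q x z) ->
  (forall x, 0 <= q x x) -> positive_form q.
Proof.
move=> ql qr qp; split=> // x y.
have im z : complex.Im (q z z) = 0 by apply: ger0_Im.
have := im (1 *: x + y); have := im ('i%C *: x + y).
rewrite !ql !qr rmorph1 !mul1r.
have := im x; have := im y.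
case: (q x x) (q x y) (q y x) (q y y) => [a b] [c d] [a' b'] [c' d'] /= *.
apply/eqP; rewrite eq_complex /=; apply/andP; split; apply/eqP; lra.
Qed.

(** * Approximate units in C*-algebras *)

Section RealNorm.
Variable R : realType.

(** Norms take their values in [R[i]]; this real version makes estimates accessible to real
    arithmetic. *)
Definition nm (V : normedZmodType R[i]) (x : V) : R := complex.Re `|x|.

Section NormedZmodule.
Variable V : normedZmodType R[i].
Implicit Types x y : V.

Lemma nmE x : `|x| = (nm x)%:C. Proof. exact: ge0_ReE. Qed.

Lemma nm_ge0 x : 0 <= nm x. Proof. exact: ge0_Re. Qed.

Lemma nm0 : nm (0 : V) = 0. Proof. by rewrite /nm normr0. Qed.

Lemma nm_eq0 x : nm x = 0 -> x = 0.
Proof. by move=> x0; apply: normr0_eq0; rewrite nmE x0. Qed.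

Lemma nmN x : nm (- x) = nm x. Proof. by rewrite /nm normrN. Qed.

Lemma nmBC x y : nm (x - y) = nm (y - x). Proof. by rewrite -nmN opprB. Qed.

Lemma nmD x y : nm (x + y) <= nm x + nm y.
Proof. by rewrite -lecR rmorphD/= -!nmE ler_normD. Qed.

Lemma nmB x y : nm (x - y) <= nm x + nm y.
Proof. by rewrite -(nmN y) nmD. Qed.

Lemma nm_le_eps x K : 0 <= K -> (forall e : R, 0 < e -> nm x <= K * e) -> x = 0.
Proof.
move=> K0 h; apply: nm_eq0; apply/eqP; rewrite eq_le nm_ge0 andbT.
exact: le0_eps h.
Qed.

End NormedZmodule.

Lemma nm_sqmod (c : R[i]) : nm c ^+ 2 = sqmod c.
Proof. by apply: complexI; rewrite rmorphXn/= -nmE sqmodE. Qed.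

Lemma nmM (c d : R[i]) : nm (c * d) = nm c * nm d.
Proof. by apply: complexI; rewrite rmorphM/= -!nmE normrM. Qed.

Lemma nmR (r : R) : nm (r%:C : R[i]) = `|r|.
Proof.
by apply/eqP; rewrite -(eqrXn2 (n := 2))// ?nm_ge0// nm_sqmod sqmodR real_normK ?num_real.
Qed.

Lemma nm_iR (r : R) : 0 <= r -> nm ('i * r%:C : R[i]) = r.
Proof. by move=> r0; rewrite nmM nmR ger0_norm// /nm normCi mul1r. Qed.

Lemma Re_le_nm (c : R[i]) : complex.Re c <= nm c.
Proof.
by rewrite -lecR -nmE (le_trans _ (normc_ge_Re _))// lecR ler_norm.
Qed.

Lemma nmZ (V : normedModType R[i]) a (x : V) : nm (a *: x) = nm a * nm x.
Proof. by apply: complexI; rewrite rmorphM/= -!nmE normrZ. Qed.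

Lemma nm_cvgP (V : normedModType R[i]) (u : nat -> V) l :
  u @ \oo --> l <->
  forall e : R, 0 < e -> exists N, forall n, (N <= n)%N -> nm (u n - l) <= e.
Proof.
split.
  move=> /cvgrPdist_le h e e0; have /h[N _ hN] : 0 < e%:C :> R[i] by rewrite rC_gt0.
  by exists N => n /hN /=; rewrite nmE lecR nmBC.
move=> h; apply/cvgrPdist_le => e e0.
have [|N hN] := h (complex.Re e); first by rewrite -rC_gt0 -ge0_ReE// ltW.
exists N => // n /= /hN; rewrite nmBC -lecR -nmE -ge0_ReE//.
exact: ltW.
Qed.

Lemma nm_complete (V : completeNormedModType R[i]) (u : nat -> V) :
  (forall e : R, 0 < e -> exists N, forall m n, (N <= m)%N -> (N <= n)%N ->
    nm (u m - u n) <= e) ->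
  exists l, forall e : R, 0 < e -> exists N, forall n, (N <= n)%N ->
    nm (u n - l) <= e.
Proof.
move=> cu; have : cauchy (u @ \oo).
  apply: cauchy_exP => e e0.
  have e'0 : 0 < complex.Re e / 2.
    by rewrite divr_gt0// -rC_gt0 -ge0_ReE// ltW.
  have [N hN] := cu _ e'0; exists (u N), N => // n /= Nn.
  rewrite -ball_normE /= nmE [e in _ < e]ge0_ReE ?ltW// ltcR.
  by apply: le_lt_trans (hN _ _ _ Nn) _ => //; lra.
by move=> /cauchy_cvg /cvg_ex[l /nm_cvgP hl]; exists l.
Qed.

End RealNorm.

Section CStarAlgebra.
Variables (R : realType) (A : cstarAlgType R).
Implicit Types (a b g h x y : A) (s : R) (z : R[i]).

Lemma amulDl a b x : amul (a + b) x = amul a x + amul b x.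
Proof. exact: linD (amul_linearl x) a b. Qed.
Lemma amulBl a b x : amul (a - b) x = amul a x - amul b x.
Proof. exact: linB (amul_linearl x) a b. Qed.
Lemma amulZl z a x : amul (z *: a) x = z *: amul a x.
Proof. exact: linZ (amul_linearl x) z a. Qed.
Lemma amul0l x : amul 0 x = 0.
Proof. exact: lin0 (amul_linearl x). Qed.
Lemma amulDr x a b : amul x (a + b) = amul x a + amul x b.
Proof. exact: linD (amul_linearr x) a b. Qed.
Lemma amulBr x a b : amul x (a - b) = amul x a - amul x b.
Proof. exact: linB (amul_linearr x) a b. Qed.
Lemma amulZr z x a : amul x (z *: a) = z *: amul x a.
Proof. exact: linZ (amul_linearr x) z a. Qed.
Lemma amul0r x : amul x 0 = 0.
Proof. exact: lin0 (amul_linearr x). Qed.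

Lemma star0 : star (0 : A) = 0.
Proof.
have := star_antilinear 1 (0 : A) 0; rewrite !scale1r addr0 rmorph1 scale1r.
by move/(congr1 (fun x => x - star 0)); rewrite subrr addrK.
Qed.
Lemma starD a b : star (a + b) = star a + star b.
Proof. by have := star_antilinear 1 a b; rewrite !scale1r rmorph1 scale1r. Qed.
Lemma starZ z a : star (z *: a) = z^* *: star a.
Proof. by have := star_antilinear z a 0; rewrite !addr0 star0 addr0. Qed.
Lemma starN a : star (- a) = - star a.
Proof. by rewrite -scaleN1r starZ rmorphN1 scaleN1r. Qed.
Lemma starB a b : star (a - b) = star a - star b.
Proof. by rewrite starD starN. Qed.

Lemma nm_amul a b : nm (amul a b) <= nm a * nm b.
Proof. by rewrite -lecR rmorphM/= -!nmE norm_amul. Qed.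

Lemma nm_cstar a : nm (amul (star a) a) = nm a ^+ 2.
Proof. by apply: complexI; rewrite rmorphXn/= -!nmE cstar_identity. Qed.

Lemma nm_star a : nm (star a) = nm a.
Proof.
suff h b : nm b <= nm (star b).
  by apply/eqP; rewrite eq_le h -{2}(starK a) h.
have [->|b0] := eqVneq b 0; first by rewrite star0.
have nb : 0 < nm b.
  by rewrite lt_neqAle nm_ge0 andbT eq_sym; apply: contra b0 => /eqP/nm_eq0 ->.
by rewrite -(ler_pM2r nb) -expr2 -nm_cstar nm_amul.
Qed.

(* [g'] is [g (1 + z g)^-1], the inverse being a Neumann series. *)
Lemma quasi_inverse g z : nm z * nm g <= 2^-1 ->
  exists g', g' + z *: amul g g' = g /\
    forall h, amul h g = amul g h -> amul h g' = amul g' h.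
Proof.
move=> zg; pose x := fix x n := if n is m.+1 then g - z *: amul g (x m) else 0.
have half y : nm (z *: amul g y) <= 2^-1 * nm y.
  rewrite nmZ (le_trans (ler_wpM2l (nm_ge0 z) (nm_amul g y)))//.
  by rewrite mulrA ler_wpM2r// nm_ge0.
have bx k : nm (x k) <= 2 * nm g.
  elim: k => [|k ih]; first by rewrite nm0 mulr_ge0// nm_ge0.
  have := half (x k); have := nmB g (z *: amul g (x k)) => /=; lra.
have dx n k : nm (x (n + k)%N - x n) <= 2^-1 ^+ n * (2 * nm g).
  elim: n => [|n ih]; first by rewrite add0n subr0 expr0 mul1r bx.
  rewrite addSn /= opprB addrC subrKA -scalerBr -amulBr.
  rewrite exprS -mulrA; apply: le_trans (half _) _.
  by rewrite nmBC ler_pM2l ?invr_gt0.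
have small (e : R) : 0 < e -> exists N, 2^-1 ^+ N * (2 * nm g) <= e.
  move=> e0; pose K := 2 * nm g / e.
  have K0 : 0 <= K by rewrite divr_ge0 ?mulr_ge0// ?nm_ge0// ltW.
  have [N KN] : exists N : nat, K <= N%:R.
    by exists (Num.truncn K).+1; rewrite ltW// truncnS_gt.
  exists N; rewrite exprVn mulrC ler_pdivrMr ?exprn_gt0// [e * _]mulrC -ler_pdivrMr//.
  by apply: le_trans KN _; rewrite -natrX ler_nat ltnW// ltn_expl.
have [g' hg'] : exists g', forall e : R, 0 < e -> exists N, forall n, (N <= n)%N ->
    nm (x n - g') <= e.
  apply: nm_complete => e e0; have [|N hN] := small (e / 2); first by lra.
  exists N => m n Nm Nn; have := dx N (m - N)%N; have := dx N (n - N)%N.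
  rewrite !subnKC// => hn hm.
  by rewrite -(subrKA (x N)) (le_trans (nmD _ _))// (nmBC (x N)); lra.
exists g'; split.
  apply/eqP; rewrite -subr_eq0; apply/eqP; apply: (@nm_le_eps _ _ _ 2) => // e e0.
  have [N hN] := hg' e e0.
  have -> : g' + z *: amul g g' - g = (g' - x N.+1) + z *: amul g (g' - x N).
    by rewrite amulBr scalerBr /= opprB addrACA [_ - g - _]addrAC subrr sub0r.
  have := half (g' - x N); rewrite nmBC; have := hN N (leqnn _).
  have := hN N.+1 (leqnSn _); have := nmD (g' - x N.+1) (z *: amul g (g' - x N)).
  rewrite (nmBC g' (x N.+1)); lra.
move=> h hg; have hx n : amul h (x n) = amul (x n) h.
  elim: n => [|n ih] /=; first by rewrite amul0l amul0r.
  by rewrite amulBl amulBr amulZl amulZr hg amulA hg -!amulA ih.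
apply/eqP; rewrite -subr_eq0; apply/eqP.
apply: (@nm_le_eps _ _ _ (2 * nm h)); first by rewrite mulr_ge0// nm_ge0.
move=> e e0; have [N hN] := hg' e e0; have {}hN := hN N (leqnn _).
have -> : amul h g' - amul g' h = amul (x N - g') h - amul h (x N - g').
  by rewrite amulBl amulBr hx opprB [RHS]addrC subrKA.
apply: le_trans (nmB _ _) _.
have := nm_amul (x N - g') h; have := nm_amul h (x N - g').
have := ler_wpM2l (nm_ge0 h) hN; lra.
Qed.

(* [g] is [h (1 + i s h)^-1], which stays in [A] although [A] need not be unital. *)
Definition resolvent_at h s g :=
  amul h g = amul g h /\ g + ('i * s%:C) *: amul h g = h.

(** For self-adjoint [h], [star g] is the resolvent h (1 - i s h)^-1 at [- s], and this is the
    resolvent identity for the pair. *)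
Lemma resolvent_star h s g : star h = h -> resolvent_at h s g ->
  star g - g = (2 * ('i * s%:C)) *: amul (star g) g.
Proof.
move=> hh [_ e]; set z := 'i * s%:C in e *.
have zJ : z^* = - z by rewrite rmorphM/= conj_rC conjCi mulNr.
have e' : star g - z *: amul (star g) h = h.
  by have := congr1 star e; rewrite starD starZ starM hh zJ scaleNr.
have e1 : amul (star g) g + z *: amul (star g) (amul h g) = amul (star g) h.
  by rewrite -amulZr -amulDr e.
have e2 : amul (star g) g - z *: amul (star g) (amul h g) = amul h g.
  by rewrite -[in RHS]e' amulBl amulZl amulA.
have -> : (2 * z) *: amul (star g) g = z *: (amul (star g) h + amul h g).
  by rewrite -e1 -{2}e2 addrACA subrr addr0 -mulr2n -[in RHS]scaler_nat scalerA mulrC.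
rewrite scalerDr; have -> : z *: amul h g = h - g by rewrite -{2}e addrC addKr.
have -> : z *: amul (star g) h = star g - h by rewrite -{2}e' opprB addrC subrK.
by rewrite subrKA.
Qed.

Section Resolvent.
Variables (h g : A) (s : R).
Hypotheses (hh : star h = h) (s0 : 0 < s) (hg : resolvent_at h s g).

Let nmis : nm ('i * s%:C : R[i]) = s.
Proof. exact/nm_iR/ltW. Qed.

(** By the C*-identity, [resolvent_star] gives 2 s |g|^2 = |g^* - g| <= 2 |g|. *)
Lemma resolvent_nm : s * nm g <= 1.
Proof.
have := nmB (star g) g; rewrite (resolvent_star hh hg) nmZ nm_cstar nm_star.
rewrite nmM nmis -(rmorph_nat (real_complex R)) nmR ger0_norm//.
have [->|g0] := eqVneq (nm g) 0; first by rewrite mulr0.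
have gp : 0 < nm g by rewrite lt0r g0 nm_ge0.
by move=> h2; rewrite -(ler_pM2r gp); lra.
Qed.

(** The element h - h (s h)^2 (1 + (s h)^2)^-1 equals h (1 + (s h)^2)^-1, which is the mean of [g]
    and [star g]. *)
Lemma resolvent_approx_unit :
  nm (h - amul h ((s ^+ 2)%:C *: amul (star g) g)) <= nm g.
Proof.
set z := 'i * s%:C.
have zJ : z^* = - z by rewrite rmorphM/= conj_rC conjCi mulNr.
case: (hg) => c e.
have e' : star g - z *: amul h (star g) = h.
  by have := congr1 star e; rewrite starD starZ c starM hh zJ scaleNr.
have e1 : star g - g = (2 * z) *: amul (star g) g := resolvent_star hh hg.
have s2 : (s ^+ 2)%:C = - (z * z).
  by rewrite mulrACA -expr2 sqrCi mulN1r opprK rmorphXn.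
have -> : h - amul h ((s ^+ 2)%:C *: amul (star g) g) = 2^-1 *: (g + star g).
  rewrite amulZr s2 scaleNr opprK -scalerA amulA -amulZl.
  have -> : z *: amul h (star g) = star g - h by rewrite -{2}e' opprB addrC subrK.
  rewrite amulBl scalerBr.
  have -> : z *: amul h g = h - g by rewrite -{2}e addrC addKr.
  have -> : z *: amul (star g) g = 2^-1 *: (star g - g).
    by rewrite e1 scalerA mulrA mulVf ?pnatr_eq0// mul1r.
  rewrite opprB addrCA [h + (g - h)]addrC subrK.
  apply: (scalerI (a := 2)); first by rewrite pnatr_eq0.
  rewrite scalerDr !scalerA mulfV ?pnatr_eq0// !scale1r scaler_nat mulr2n.
  by rewrite addrA subrK addrC.
rewrite nmZ; have -> : nm (2^-1 : R[i]) = 2^-1.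
  by rewrite -(rmorph_nat (real_complex R)) -fmorphV nmR ger0_norm ?invr_ge0.
have := nmD g (star g); rewrite nm_star; lra.
Qed.

End Resolvent.

(** A Neumann series at 0 reaches only small [s]. As [s * nm g <= 1], expanding around the present
    [g] with increment [s / 2] again has ratio at most 1/2, so [s] can be enlarged indefinitely. *)
Lemma resolvent_step h s g : star h = h -> 0 < s -> resolvent_at h s g ->
  exists g', resolvent_at h (s + s / 2) g'.
Proof.
move=> hh s0 hg; have sg := resolvent_nm hh s0 hg; case: hg => c e.
have [|g' [eg' cg']] := @quasi_inverse g ('i * (s / 2)%:C).
  by rewrite nm_iR; [lra | rewrite divr_ge0// ltW].
exists g'; split; first exact: cg'.
rewrite rmorphD mulrDr scalerDl addrA.
set w := 'i * (s / 2)%:C in eg' *; set z := 'i * s%:C in e *.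
have -> : w *: amul h g' = (g - g') + z *: amul h (g - g').
  have <- : w *: amul g g' = g - g' by rewrite -{2}eg' addrC addKr.
  by rewrite -{1}e amulDl scalerDr amulZl amulZr -amulA !scalerA [w * z]mulrC.
by rewrite amulBr scalerBr addrC addrACA subrK subrK.
Qed.

Lemma resolvent_exists h K : star h = h ->
  exists s g, [/\ 0 < s, K <= s & resolvent_at h s g].
Proof.
(* Chosen so that [s0 * nm h <= 1/2], as the first Neumann series requires. *)
move=> hh; pose s0 : R := (2 * (nm h + 1))^-1.
have h1 : 0 < nm h + 1 by rewrite ltr_wpDl// nm_ge0.
have s00 : 0 < s0 by rewrite invr_gt0 mulr_gt0.
(* Each step multiplies [s] by 3/2; the weaker linear growth recorded here already passes [K]. *)
have step (n : nat) : exists s g, s0 * (1 + n%:R / 2) <= s /\ resolvent_at h s g.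
  elim: n => [|n [s [g [ss hg]]]].
    have [|g [eg cg]] := @quasi_inverse h ('i * s0%:C).
      rewrite nm_iR ?(ltW s00)// /s0 invfM -mulrA.
      by rewrite ler_piMr ?invr_ge0// mulrC ler_pdivrMr// mul1r lerDl.
    by exists s0, g; split; [rewrite mul0r addr0 mulr1 | split=> //; exact: cg].
  have n0 : (0 : R) <= n%:R by [].
  have sp : s0 <= s by apply: le_trans ss; rewrite ler_pMr// lerDl divr_ge0.
  have [g' hg'] := resolvent_step hh (lt_le_trans s00 sp) hg.
  exists (s + s / 2), g'; split=> //; rewrite -natr1; nra.
pose n := (Num.truncn (2 * K / s0)).+1.
have [s [g [ss hg]]] := step n.
have Kn : 2 * K / s0 <= n%:R by rewrite ltW// truncnS_gt.
exists s, g; split=> //.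
  by apply: lt_le_trans ss; rewrite mulr_gt0// ltr_wpDr// divr_ge0.
apply: le_trans ss; move: Kn; rewrite ler_pdivrMr// => Kn; nra.
Qed.

(* [y] is [(s h)^2 (1 + (s h)^2)^-1] for [h = b b^*] and [s] large. In terms of the
   resolvent [g] the bound [|y| <= 1] follows from [g^* - g = 2 i s g^* g] and the
   C*-identity, without spectral theory. *)
Lemma approximate_unit b (e : R) : 0 < e -> exists (r : R) g,
  let y := r%:C *: amul (star g) g in
  [/\ 0 <= r, nm y <= 1 & nm (b - amul y b) <= e].
Proof.
move=> e0; pose h := amul b (star b).
have hh : star h = h by rewrite starM starK.
(* The C*-identity bounds |b - y b|^2 = |(1 - y) h (1 - y)| by 2 |h - h y| <= 2 |g| <= 2 / s, which
   should be at most e^2. *)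
have [s [g [s0 Ks hg]]] := resolvent_exists (2 / e ^+ 2) hh.
exists (s ^+ 2), g => y; have sg := resolvent_nm hh s0 hg.
have y1 : nm y <= 1.
  rewrite nmZ nmR ger0_norm ?sqr_ge0// nm_cstar -exprMn expr_le1//.
  by rewrite mulr_ge0// ?nm_ge0// ltW.
split=> //; first exact: sqr_ge0.
have yy : star y = y by rewrite starZ starM starK conj_rC.
rewrite -(ler_pXn2r (n := 2)) ?nnegrE ?nm_ge0 ?(ltW e0)//.
rewrite -nm_star -nm_cstar starK starB starM yy amulBl !amulBr.
rewrite -!amulA -/h [amul b (amul _ y)]amulA -/h -amulBr.
apply: le_trans (nmB _ _) _.
have := resolvent_approx_unit hh hg; rewrite -/y => hy.
have := nm_amul y (h - amul h y).
have : nm y * nm (h - amul h y) <= nm (h - amul h y).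
  by rewrite ler_piMl// nm_ge0.
have : 2 * nm g <= e ^+ 2.
  have e2 : 0 < e ^+ 2 by rewrite exprn_gt0.
  have : 2 / e ^+ 2 * nm g <= 1 by apply: le_trans sg; rewrite ler_wpM2r// nm_ge0.
  by rewrite mulrAC ler_pdivrMr// mul1r.
lra.
Qed.

Definition functional_form (F : A -> R[i]) a b := F (amul (star b) a).

Lemma functional_form_positive (F : A -> R[i]) : scalar F ->
  (forall a, 0 <= F (amul (star a) a)) -> positive_form (functional_form F).
Proof.
move=> lF F0; apply: sesquilinear_hermitian => //.
  by move=> y c a b; rewrite /functional_form amulDr amulZr lF.
by move=> c x y z; rewrite /functional_form star_antilinear amulDl amulZl lF.
Qed.

(** In a unital algebra this is Cauchy-Schwarz of [b] against 1. Here [y = r g^* g] stands for the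
    unit: F (y b) is [r] times the form at [amul g b] and [g], and F y <= 1. *)
Lemma Kadison (F : A -> R[i]) b : scalar F ->
  (forall a, 0 <= F (amul (star a) a)) -> (forall a, nm (F a) <= nm a) ->
  sqmod (F b) <= complex.Re (F (amul (star b) b)).
Proof.
move=> lF F0 F1; have qP := functional_form_positive lF F0.
apply: le_eps => e0 e00.
(* Squaring [d1] costs 2 |b| e + e^2 and [d3] costs |b| e; with [e <= 1] the total is at most
   [K * e]. *)
pose K := 3 * nm b + 1.
have K0 : 0 < K by rewrite /K; have := nm_ge0 b; lra.
pose e := Num.min 1 (e0 / K).
have ep : 0 < e by rewrite lt_min ltr01 divr_gt0.
have e1 : e <= 1 by rewrite ge_min lexx.
have eK : K * e <= e0 by rewrite mulrC -ler_pdivlMr// ge_min lexx orbT.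
have [r [g [/= r0]]] := approximate_unit b ep.
set y := _ *: _ => y1 yb.
have yF : sqmod (F (amul y b)) <= complex.Re (F (amul (star b) (amul y b))).
  have -> : F (amul y b) = r%:C * functional_form F (amul g b) g.
    by rewrite /functional_form -(scalZ lF) amulA -amulZl.
  have -> : complex.Re (F (amul (star b) (amul y b))) =
      r * nsq (functional_form F) (amul g b).
    by rewrite /y /nsq /functional_form amulZl amulZr (scalZ lF) ReZ starM !amulA.
  rewrite sqmodM sqmodR.
  apply: le_trans (ler_wpM2l (sqr_ge0 _) (Cauchy_Schwarz qP _ _)) _.
  have : r * nsq (functional_form F) g <= 1.
    rewrite /nsq /functional_form -ReZ -[_%:C * _](scalZ lF).
    by apply: le_trans (Re_le_nm _) _; apply: le_trans (F1 _) _.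
  have := nsq_ge0 qP (amul g b); set u := nsq _ (amul g b); set v := nsq _ g.
  by move=> u0 rv; have := mulr_ge0 r0 u0; nra.
have d1 : nm (F b) <= nm (F (amul y b)) + e.
  have := nmD (F (amul y b)) (F (b - amul y b)).
  by rewrite (scalB lF) addrC subrK -(scalB lF); have := F1 (b - amul y b); lra.
have d2 : nm (F (amul y b)) <= nm b.
  apply: le_trans (F1 _) _; apply: le_trans (nm_amul _ _) _.
  by rewrite ler_piMl// nm_ge0.
have d3 : complex.Re (F (amul (star b) (amul y b))) <=
    complex.Re (F (amul (star b) b)) + nm b * e.
  have -> : amul (star b) (amul y b) = amul (star b) b + amul (star b) (amul y b - b).
    by rewrite amulBr addrC subrK.
  rewrite (scalD lF) ReD lerD2l (le_trans (Re_le_nm _))// (le_trans (F1 _))//.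
  apply: le_trans (nm_amul _ _) _; rewrite nm_star nmBC.
  by rewrite ler_wpM2l// nm_ge0.
move: yF; rewrite -!nm_sqmod.
have := nm_ge0 (F b); have := nm_ge0 (F (amul y b)).
move: eK; rewrite /K; nra.
Qed.

End CStarAlgebra.

(** * Square-summable sequences in a Hilbert space *)

Section Hilbert.
Variables (R : realType) (H : hilbertType R).
Implicit Types (x y z : H) (X Y : H -> H).

Lemma inner_form : positive_form (@inner R H).
Proof.
split=> [y a x z|x y|x]; first by rewrite linearPl.
  by rewrite hermC expr0 mul1r.
by rewrite inner_norm exprn_ge0.
Qed.

Definition hsq : H -> R := nsq (@inner R H).

Lemma hsqE x : hsq x = nm x ^+ 2.
Proof. by apply: complexI; rewrite rmorphXn/= -nmE -inner_norm -nsqE//; exact: inner_form. Qed.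

Lemma hsq_ge0 x : 0 <= hsq x. Proof. exact: nsq_ge0 inner_form x. Qed.

Lemma hsq_eq0 x : hsq x = 0 -> x = 0.
Proof. by move=> /eqP; rewrite hsqE sqrf_eq0 => /eqP/nm_eq0. Qed.

Lemma hsq_le0_eps x K : 0 <= K -> (forall e : R, 0 < e -> hsq x <= K * e) -> x = 0.
Proof.
move=> K0 h; apply: hsq_eq0; apply/eqP; rewrite eq_le hsq_ge0 andbT.
exact: le0_eps h.
Qed.

Lemma nm_le_hsq x (e : R) : 0 < e -> (nm x <= e) = (hsq x <= e ^+ 2).
Proof. by move=> e0; rewrite hsqE ler_pXn2r// nnegrE ?nm_ge0// ltW. Qed.

Lemma inner_complete : form_complete (@inner R H).
Proof.
move=> u cu; have [|l hl] := @nm_complete _ _ u.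
  move=> e e0; have [N hN] := cu (e ^+ 2) (exprn_gt0 2 e0).
  by exists N => m n Nm Nn; rewrite nm_le_hsq// hN.
exists l => e e0; have se : 0 < Num.sqrt e by rewrite sqrtr_gt0.
have [N hN] := hl _ se; exists N => n /hN.
by rewrite nm_le_hsq// sqr_sqrtr// ltW.
Qed.

(** [K] bounds the square of the operator norm, so that no square roots occur. *)
Definition bounded_by (K : R) X : Prop :=
  [/\ linear X, 0 <= K & forall x, hsq (X x) <= K * hsq x].

Lemma bounded_opP X : bounded_op X <-> exists K, bounded_by K X.
Proof.
split=> [[lX cX]|[K [lX K0 XK]]].
  pose g : {linear H -> H} := HB.pack X (GRing.isLinear.Build _ _ _ _ X lX).
  have /linear_boundedP : bounded_near g (nbhs 0).
    by apply/linear_bounded_continuous.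
  move=> /pinfty_ex_gt0[r r0 Xr]; exists (complex.Re r ^+ 2).
  split=> //; first exact: sqr_ge0.
  have r'0 : 0 <= complex.Re r by rewrite ge0_Re// ltW.
  move=> x; rewrite !hsqE -exprMn ler_pXn2r ?nnegrE ?nm_ge0 ?mulr_ge0 ?nm_ge0//.
  by rewrite -lecR rmorphM/= -!nmE -(ge0_ReE (ltW r0)); exact: Xr.
split=> // x; apply/cvgrPdist_le => e e0.
have e'0 : 0 < complex.Re e by rewrite -rC_gt0 -ge0_ReE// ltW.
pose d := complex.Re e / (K + 1).
have d0 : 0 < d by rewrite divr_gt0// ltr_wpDl.
near=> y; rewrite nmE [e in _ <= e](ge0_ReE (ltW e0)) lecR nm_le_hsq// -(linB lX).
apply: le_trans (XK _) _.
have xy : nm (x - y) <= d.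
  rewrite -lecR -nmE; near: y.
  by apply: (@cvgr_dist_le _ _ _ (nbhs x) _ id x) => //; rewrite rC_gt0.
have : hsq (x - y) <= d ^+ 2 by rewrite -nm_le_hsq.
have -> : complex.Re e = d * (K + 1) by rewrite divfK// gt_eqF// ltr_wpDl.
move=> xy2; apply: le_trans (ler_wpM2l K0 xy2) _.
have := sqr_ge0 d; nra.
Unshelve. all: by end_near. Qed.

Lemma dense_approx (T : Type) (f : T -> H) x (e : R) :
  dense (range f) -> 0 < e -> exists t, hsq (x - f t) <= e.
Proof.
move=> df e0; have se : 0 < Num.sqrt e by rewrite sqrtr_gt0.
have [||y [bx [t _ ty]]] := df (ball x (Num.sqrt e)%:C).
- by exists x; apply: ballxx; rewrite rC_gt0.
- by apply: ball_open; rewrite rC_gt0.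
exists t; move: bx; rewrite -ty -ball_normE /= nmE ltcR => /ltW.
by rewrite nm_le_hsq// sqr_sqrtr// ltW.
Qed.

Lemma inner_ext x y : (forall z, inner x z = inner y z) -> x = y.
Proof.
move=> h; apply/eqP; rewrite -subr_eq0; apply/eqP; apply: hsq_eq0.
by rewrite /hsq /nsq (formBl inner_form) h subrr.
Qed.

Lemma comp_bounded_op X Y : bounded_op X -> bounded_op Y -> bounded_op (X \o Y).
Proof.
move=> [lX cX] [lY cY]; split; first by move=> a x y /=; rewrite lY lX.
by move=> x; apply: continuous_comp; [exact: cY | exact: cX].
Qed.

Lemma bicommutant_comp (M : set (H -> H)) X Y :
  bicommutant M X -> bicommutant M Y -> bicommutant M (X \o Y).
Proof.
move=> [bX cX] [bY cY]; split; first exact: comp_bounded_op.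
move=> T MT; rewrite -[X \o Y \o T]compA; have -> := cY _ MT.
by rewrite compA; have -> := cX _ MT.
Qed.

Lemma sub_bicommutant (M : set (H -> H)) X :
  (forall Y, M Y -> bounded_op Y) -> M X -> bicommutant M X.
Proof. by move=> bM MX; split; [exact: bM | move=> Y [_ /(_ _ MX)]]. Qed.

End Hilbert.

Section Series.
Variable R : realType.

Lemma real_complete (u : nat -> R) :
  (forall e : R, 0 < e -> exists N, forall m n, (N <= m)%N -> (N <= n)%N ->
    `|u m - u n| <= e) ->
  exists l, forall e : R, 0 < e -> exists N, forall n, (N <= n)%N ->
    `|u n - l| <= e.
Proof.
move=> cu; have : cauchy (u @ \oo).
  apply: cauchy_exP => e e0; have [|N hN] := cu (e / 2); first by rewrite divr_gt0.
  exists (u N), N => // n /= Nn; rewrite -ball_normE /=.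
  by apply: le_lt_trans (hN _ _ _ Nn) _ => //; lra.
move=> /cauchy_cvg /cvg_ex[l /cvgrPdist_le hl]; exists l => e /hl[N _ hN].
by exists N => n /hN; rewrite distrC.
Qed.

Lemma complex_complete (u : nat -> R[i]) :
  (forall e : R, 0 < e -> exists N, forall m n, (N <= m)%N -> (N <= n)%N ->
    nm (u m - u n) <= e) ->
  exists l : R[i], forall e : R, 0 < e -> exists N, forall n, (N <= n)%N ->
    nm (u n - l) <= e.
Proof.
have reim (c : R[i]) : `|complex.Re c| <= nm c /\ `|complex.Im c| <= nm c.
  have c2 := nm_sqmod c; split; rewrite -(ler_pXn2r (n := 2)) ?nnegrE ?nm_ge0//;
    by rewrite c2 real_normK ?num_real// ?lerDl ?lerDr sqr_ge0.
have nm_le (c : R[i]) : nm c <= `|complex.Re c| + `|complex.Im c|.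
  rewrite -(ler_pXn2r (n := 2)) ?nnegrE ?nm_ge0 ?addr_ge0// nm_sqmod /sqmod.
  rewrite sqrrD !real_normK ?num_real//.
  by rewrite addrAC lerDl mulrn_wge0// mulr_ge0.
move=> cu.
have [|a ha] := @real_complete (fun n => complex.Re (u n)).
  move=> e /cu[N hN]; exists N => m n Nm Nn /=; rewrite -ReB.
  by apply: le_trans (hN _ _ Nm Nn); case: (reim (u m - u n)).
have ImB (c d : R[i]) : complex.Im (c - d) = complex.Im c - complex.Im d.
  by case: c d => [? ?] [? ?].
have [|b hb] := @real_complete (fun n => complex.Im (u n)).
  move=> e /cu[N hN]; exists N => m n Nm Nn /=; rewrite -ImB.
  by apply: le_trans (hN _ _ Nm Nn); case: (reim (u m - u n)).
exists (a +i* b) => e e0; have e2 : 0 < e / 2 by rewrite divr_gt0.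
have [N hN] := ha _ e2; have [N' hN'] := hb _ e2; exists (maxn N N') => n.
rewrite geq_max => /andP[/hN /= h1 /hN' /= h2].
apply: le_trans (nm_le _) _; rewrite ReB ImB /=; lra.
Qed.

Lemma bounded_sum_tail (a : nat -> R) C : (forall n, 0 <= a n) ->
  (forall N : nat, \sum_(0 <= n < N) a n <= C) ->
  forall e, 0 < e -> exists N0, forall m N, (N0 <= m)%N -> (m <= N)%N ->
    \sum_(m <= n < N) a n <= e.
Proof.
move=> a0 aC e e0; pose s N := \sum_(0 <= n < N) a n.
have hs : has_sup (range s).
  split; first by exists (s 0%N), 0%N.
  by exists C => _ [N _ <-]; exact: aC.
have [_ [N0 _ <-] hN0] := sup_adherent e0 hs.
exists N0 => m N N0m mN.
have sN : s N <= sup (range s) by apply: ub_le_sup; [case: hs | exists N].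
have sm : s m = s N0 + \sum_(N0 <= n < m) a n by rewrite /s -big_cat_nat.
have sNm : s N = s m + \sum_(m <= n < N) a n by rewrite /s -big_cat_nat.
have : 0 <= \sum_(N0 <= n < m) a n by apply: sumr_ge0.
lra.
Qed.

End Series.

(** * The Hilbert space of square-summable sequences *)

Section SquareSummable.
Variables (R : realType) (H : hilbertType R).
Implicit Types (xi eta : nat -> H).

(** Finite blocks are positive forms on all sequences, so the Cauchy-Schwarz inequality for forms
    controls the tails of inner product series. *)
Definition partial_form (m N : nat) xi eta : R[i] :=
  \sum_(m <= n < N) inner (xi n) (eta n).

Lemma partial_form_positive m N : positive_form (partial_form m N).
Proof.
have qP := @inner_form R H; split=> [y a x z|x y|x].
- rewrite /partial_form mulr_sumr -big_split /=; apply: eq_bigr => i _.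
  by rewrite (formDl qP) (formZl qP).
- by rewrite /partial_form rmorph_sum; apply: eq_bigr => i _; exact: formC.
- by apply: sumr_ge0 => i _; case: qP.
Qed.

Lemma partial_form_nsq m N xi :
  nsq (partial_form m N) xi = \sum_(m <= n < N) hsq (xi n).
Proof. by apply: (big_morph _ (@ReD R)). Qed.

Definition l2_pred : {pred nat -> H} :=
  [pred xi | `[< exists C, forall N, \sum_(0 <= n < N) hsq (xi n) <= C >]].

Lemma l2P xi : reflect (exists C, forall N, \sum_(0 <= n < N) hsq (xi n) <= C)
  (xi \in l2_pred).
Proof. exact: asboolP. Qed.

Lemma l2_submod_closed : submod_closed l2_pred.
Proof.
split.
  apply/l2P; exists 0 => N; rewrite big1// => i _.
  by rewrite /hsq nsq0//; exact: inner_form.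
move=> a xi eta /l2P[C hC] /l2P[D hD]; apply/l2P.
exists (2 * (sqmod a * C) + 2 * D) => N; rewrite -partial_form_nsq.
apply: le_trans (nsqD_le (partial_form_positive 0 N) _ _) _.
rewrite (nsqZ (partial_form_positive 0 N)) !partial_form_nsq.
by apply: lerD; rewrite ler_pM2l// ler_wpM2l ?sqmod_ge0.
Qed.

HB.instance Definition _ :=
  GRing.isSubmodClosed.Build R[i] (nat -> H) l2_pred l2_submod_closed.

Record l2 := L2 { l2val :> nat -> H; _ : l2val \in l2_pred }.

HB.instance Definition _ := [isSub for l2val].
HB.instance Definition _ := [Choice of l2 by <:].
HB.instance Definition _ := [SubChoice_isSubLmodule of l2 by <:].

Lemma l2valP (xi : l2) : exists C, forall N, \sum_(0 <= n < N) hsq (xi n) <= C.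
Proof. by apply/l2P; exact: valP. Qed.

Lemma l2val_lin a (xi eta : l2) n : (a *: xi + eta : l2) n = a *: xi n + eta n.
Proof. by []. Qed.

Lemma inner_series_cvg xi eta : xi \in l2_pred -> eta \in l2_pred ->
  exists l : R[i], forall e : R, 0 < e -> exists N, forall n, (N <= n)%N ->
    nm (\sum_(0 <= k < n) inner (xi k) (eta k) - l) <= e.
Proof.
move=> /l2P[C hC] /l2P[D hD]; apply: complex_complete => e e0.
have [|N0 hN0] := bounded_sum_tail (fun n => hsq_ge0 (xi n)) hC (e := e); first by [].
have [|N1 hN1] := bounded_sum_tail (fun n => hsq_ge0 (eta n)) hD (e := e); first by [].
have tail m n : (maxn N0 N1 <= m)%N -> (m <= n)%N ->
    nm (partial_form m n xi eta) <= e.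
  rewrite geq_max => /andP[m0 m1] mn.
  rewrite -(ler_pXn2r (n := 2)) ?nnegrE ?nm_ge0 ?(ltW e0)// nm_sqmod.
  apply: le_trans (Cauchy_Schwarz (partial_form_positive m n) _ _) _.
  rewrite !partial_form_nsq expr2 ler_pM ?sumr_ge0 ?hN0 ?hN1//.
    by move=> i _; exact: hsq_ge0.
  by move=> i _; exact: hsq_ge0.
exists (maxn N0 N1) => m n.
wlog mn : m n / (m <= n)%N.
  move=> wl Nm Nn; have [/wl|/ltnW/wl] := leqP m n; first exact.
  by rewrite nmBC; exact.
move=> Nm Nn; rewrite nmBC (big_cat_nat (leq0n m) mn) /= addrAC subrr add0r.
exact: tail.
Qed.

Lemma series_cvgE (a : nat -> R[i]) (l : R[i]) :
  (series (a : nat -> R[i]^o)) @ \oo --> (l : R[i]^o) <->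
  forall e : R, 0 < e -> exists N, forall n, (N <= n)%N ->
    nm (\sum_(0 <= k < n) a k - l) <= e.
Proof. exact: nm_cvgP. Qed.

(** Taking the functional at [id] makes sigma-weak functionals matrix coefficients of amplified
    operators; see [sigma_weak_functionalE]. *)
Definition l2form (xi eta : l2) : R[i] := sigma_weak_functional xi eta id.

Lemma l2form_cvg (xi eta : l2) :
  (series (fun n => inner (xi n) (eta n) : R[i]^o)) @ \oo --> (l2form xi eta : R[i]^o).
Proof.
have [l hl] := inner_series_cvg (valP xi) (valP eta).
by move/series_cvgE in hl; apply: (cvgP _ hl).
Qed.

Lemma l2form_lim (xi eta : l2) (e : R) : 0 < e -> exists N, forall n, (N <= n)%N ->
  nm (partial_form 0 n xi eta - l2form xi eta) <= e.
Proof. by move: e; apply/series_cvgE/l2form_cvg. Qed.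

Lemma l2form_unique (xi eta : l2) (l : R[i]) :
  (forall e : R, 0 < e -> exists N, forall n, (N <= n)%N ->
    nm (partial_form 0 n xi eta - l) <= e) -> l2form xi eta = l.
Proof. by move=> /series_cvgE h; apply: cvg_lim h; exact: norm_hausdorff. Qed.

Lemma l2_partial_le (xi : l2) N : \sum_(0 <= n < N) hsq (xi n) <= nsq l2form xi.
Proof.
apply: le_eps => e e0; have [N' hN'] := l2form_lim xi xi e0.
have := hN' _ (leq_maxr N N'); set n := maxn N N' => hn.
have Nn : \sum_(0 <= n < N) hsq (xi n) <= nsq (partial_form 0 n) xi.
  rewrite partial_form_nsq (big_cat_nat (leq0n N) (leq_maxl N N')) /= lerDl.
  by apply: sumr_ge0 => i _; exact: hsq_ge0.
have := le_trans (Re_le_nm _) hn; rewrite ReB /nsq in Nn *; lra.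
Qed.

Lemma l2_nsq_le (xi : l2) C : (forall N, \sum_(0 <= n < N) hsq (xi n) <= C) ->
  nsq l2form xi <= C.
Proof.
move=> hC; apply: le_eps => e e0; have [N /(_ N (leqnn _))] := l2form_lim xi xi e0.
rewrite nmBC => /(le_trans (Re_le_nm _)); rewrite ReB.
have := hC N; rewrite -partial_form_nsq /nsq; lra.
Qed.

Lemma l2_coord_le (xi : l2) n : hsq (xi n) <= nsq l2form xi.
Proof.
apply: le_trans (l2_partial_le xi n.+1); rewrite big_nat_recr//= lerDr.
by apply: sumr_ge0 => i _; exact: hsq_ge0.
Qed.

Lemma l2form_positive : positive_form l2form.
Proof.
split=> [y a x z|x y|x].
- apply: l2form_unique => e e0; pose K := nm a + 1.
  have K0 : 0 < K by rewrite ltr_wpDl// nm_ge0.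
  have e'0 : 0 < e / (2 * K) by rewrite divr_gt0// mulr_gt0.
  have [N hN] := l2form_lim x y e'0; have [|N' hN'] := l2form_lim z y (e := e / 2).
    by rewrite divr_gt0.
  exists (maxn N N') => n; rewrite geq_max => /andP[/hN h1 /hN' h2].
  have -> : partial_form 0 n (a *: x + z : l2) y =
      a * partial_form 0 n x y + partial_form 0 n z y.
    by case: (partial_form_positive 0 n) => /(_ y a x z).
  rewrite opprD addrACA -mulrBr; apply: le_trans (nmD _ _) _; rewrite nmM.
  have -> : e = K * (e / (2 * K)) + e / 2 by field; rewrite gt_eqF.
  by rewrite lerD// ler_pM ?nm_ge0// lerDl.
- apply: l2form_unique => e /(l2form_lim x y)[N hN]; exists N => n /hN.
  rewrite (formC (partial_form_positive 0 n) x y) -rmorphB.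
  by rewrite /nm norm_conjC.
- have h n : partial_form 0 n x x = (\sum_(0 <= k < n) hsq (x k))%:C.
    by rewrite -partial_form_nsq nsqE//; exact: partial_form_positive.
  have x0 : 0 <= nsq l2form x by apply: le_trans (l2_coord_le x 0); exact: hsq_ge0.
  suff -> : l2form x x = (nsq l2form x)%:C by rewrite ler0c.
  apply: l2form_unique => e e0; have [N hN] := l2form_lim x x e0.
  exists N => n Nn; rewrite h -rmorphB nmR; apply: le_trans (hN n Nn).
  rewrite -partial_form_nsq /nsq -ReB.
  by rewrite -lecR -nmE normc_ge_Re.
Qed.

Lemma l2form_complete : form_complete l2form.
Proof.
have qP := @inner_form R H; have lP := l2form_positive.
move=> u cu.
have /choice[z hz] n : exists z : H, forall e : R, 0 < e -> exists N, forall k,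
    (N <= k)%N -> hsq (u k n - z) <= e.
  apply: inner_complete => e /cu[N hN]; exists N => i j Ni Nj.
  exact: le_trans (l2_coord_le (u i - u j) n) (hN _ _ Ni Nj).
(* On a finite block the coordinatewise convergence to [z] is uniform, so the Cauchy bound passes to
   the limit at the cost of a constant factor. *)
have lim k e N : (forall j, (k <= j)%N -> nsq l2form (u k - u j) <= e) ->
    \sum_(0 <= n < N) hsq (u k n - z n) <= 4 * e.
  move=> he; apply: le_eps => d d0.
  have [M hM] : exists M, forall j, (M <= j)%N ->
      \sum_(0 <= n < N) hsq (u j n - z n) <= d / 2.
    (* Each of the [N] coordinates receives this share of [d / 2]; the successor keeps the quotient
       meaningful for [N = 0]. *)
    have d'0 : 0 < d / (2 * N.+1%:R) by rewrite divr_gt0// mulr_gt0.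
    have /choice[M hM] n := hz n _ d'0.
    exists (\max_(n < N) M n) => j hj; rewrite big_mkord.
    apply: le_trans (_ : \sum_(n < N) d / (2 * N.+1%:R) <= _).
      apply: ler_sum => i _; apply: hM; apply: leq_trans hj.
      exact: (leq_bigmax i).
    rewrite sumr_const card_ord -[_ *+ N]mulr_natl mulrA ler_pdivrMr ?mulr_gt0//.
    have -> : d / 2 * (2 * N.+1%:R) = d * N.+1%:R by field.
    by rewrite [_ * d]mulrC ler_pM2l// ler_nat.
  pose j := maxn k M.
  have := nsq_split (partial_form_positive 0 N) (u k) (u j) z.
  rewrite !partial_form_nsq => /le_trans; apply.
  have h1 := le_trans (l2_partial_le (u k - u j) N) (he j (leq_maxl _ _)).
  have h2 := hM j (leq_maxr _ _).
  have two : (0 : R) <= 2 by [].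
  apply: le_trans (lerD (ler_wpM2l two h1) (ler_wpM2l two h2)) _.
  have := le_trans (nsq_ge0 lP _) (he j (leq_maxl _ _)); lra.
have zl2 : z \in l2_pred.
  have [N hN] := cu 1 ltr01; have [C hC] := l2valP (u N).
  apply/l2P; exists (2 * (4 * 1) + 2 * C) => n; rewrite -partial_form_nsq.
  have := nsqD_le (partial_form_positive 0 n) (z - u N) (u N).
  rewrite subrK => /le_trans; apply; rewrite (nsqBC (partial_form_positive 0 n)).
  rewrite !partial_form_nsq lerD// ler_pM2l//; apply: lim => j Nj.
  exact: hN.
exists (L2 zl2) => e e0; have [|N hN] := cu (e / 4); first by rewrite divr_gt0.
exists N => n Nn; apply: l2_nsq_le => k.
have -> : e = 4 * (e / 4) by field.
by apply: lim => j nj; apply: hN => //; exact: leq_trans nj.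
Qed.

Lemma l2_eq0 (xi : l2) : nsq l2form xi = 0 -> xi = 0.
Proof.
move=> h; apply: val_inj; apply/funext => n; apply: hsq_eq0; apply/eqP.
by rewrite eq_le hsq_ge0 andbT -h l2_coord_le.
Qed.

Definition single (n : nat) (v : H) : l2 :=
  insubd (0 : l2) (fun m => if m == n then v else 0).

Lemma singleE n v m : single n v m = if m == n then v else 0.
Proof.
rewrite /single insubdK//; apply/l2P; exists (hsq v) => N.
have hsq0 : hsq (0 : H) = 0 by rewrite /hsq nsq0//; exact: inner_form.
have [nN|Nn] := ltnP n N.
  rewrite big_mkord (bigD1 (Ordinal nN)) //= eqxx big1 ?addr0// => i.
  by rewrite -val_eqE /= => /negPf ->.
rewrite big_nat big1 ?hsq_ge0// => i /andP[_ iN].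
by rewrite ltn_eqF// (leq_trans iN).
Qed.

Lemma l2_trunc_cvg (xi : l2) (e : R) : 0 < e ->
  exists N, nsq l2form (xi - \sum_(0 <= n < N) single n (xi n)) <= e.
Proof.
move=> e0; have [C hC] := l2valP xi.
have [N hN] := bounded_sum_tail (fun n => hsq_ge0 (xi n)) hC e0.
exists N; have trE m : (\sum_(0 <= n < N) single n (xi n)) m = if (m < N)%N then xi m else 0.
  have -> : (\sum_(0 <= n < N) single n (xi n)) m = \sum_(0 <= n < N) single n (xi n) m.
    by elim/big_rec2 : _ => // i x y _ <-.
  have [mN|Nm] := ltnP m N.
    rewrite big_mkord (bigD1 (Ordinal mN)) //= singleE eqxx big1 ?addr0// => i.
    by rewrite -val_eqE /= singleE eq_sym => /negPf ->.
  rewrite big_nat big1// => i /andP[_ iN]; rewrite singleE gtn_eqF//.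
  exact: leq_trans Nm.
have hsq0 : hsq (0 : H) = 0 by rewrite /hsq nsq0//; exact: inner_form.
set tr := \sum_(0 <= n < N) single n (xi n) in trE *.
have dE n : hsq ((xi - tr) n) = if (n < N)%N then 0 else hsq (xi n).
  have -> : (xi - tr) n = xi n - tr n by [].
  by rewrite trE; case: ifP; rewrite ?subrr// subr0.
apply: l2_nsq_le => M.
have [MN|NM] := leqP M N.
  by rewrite big_nat big1 ?ltW// => i /andP[_ iM]; rewrite dE (leq_trans iM).
rewrite (big_cat_nat (leq0n N) (ltnW NM)) /= [X in X + _]big_nat big1 ?add0r.
  rewrite big_nat (eq_bigr (fun n => hsq (xi n))) -?big_nat ?hN// 1?ltnW//.
  by move=> i /andP[Ni _]; rewrite dE ltnNge Ni.
by move=> i /andP[_ iN]; rewrite dE iN.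
Qed.

End SquareSummable.
(** * Sigma-strong density and normality *)

Section Amplification.
Variables (R : realType) (H : hilbertType R).
Implicit Types (X Y : H -> H) (xi eta : l2 H).

Let lP := @l2form_positive R H.
Let iP := @inner_form R H.

(** The operator X tensor 1. The default 0 of [insubd] does not arise for bounded [X], by
    [bounded_l2]. *)
Definition amplify X xi : l2 H := insubd (0 : l2 H) (X \o xi).

Lemma bounded_l2 K X xi : bounded_by K X -> X \o xi \in @l2_pred R H.
Proof.
move=> [_ K0 XK]; have [C hC] := l2valP xi; apply/l2P; exists (K * C) => N.
apply: le_trans (ler_wpM2l K0 (hC N)); rewrite mulr_sumr.
by apply: ler_sum => i _; exact: XK.
Qed.

Lemma amplifyE X xi n : bounded_op X -> amplify X xi n = X (xi n).
Proof. by move=> /bounded_opP[K XK]; rewrite /amplify insubdK//; exact: bounded_l2 XK. Qed.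

Lemma l2_ext xi eta : (forall n, xi n = eta n) -> xi = eta.
Proof. by move=> h; apply: val_inj; apply/funext. Qed.

Lemma amplify_linear X : bounded_op X -> linear (amplify X).
Proof.
move=> bX a x y; apply: l2_ext => n; rewrite l2val_lin !amplifyE//.
by case: bX => lX _; rewrite l2val_lin lX.
Qed.

Lemma amplify_bounded X K xi : bounded_by K X ->
  nsq (@l2form R H) (amplify X xi) <= K * nsq (@l2form R H) xi.
Proof.
move=> XK; have bX : bounded_op X by apply/bounded_opP; exists K.
case: XK => _ K0 XK; apply: l2_nsq_le => N.
apply: le_trans (ler_wpM2l K0 (l2_partial_le xi N)); rewrite mulr_sumr.
by apply: ler_sum => i _; rewrite amplifyE.
Qed.

Lemma amplify_adjoint X Y xi eta : bounded_op X -> bounded_op Y -> adjoint X Y ->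
  l2form (amplify X xi) eta = l2form xi (amplify Y eta).
Proof.
move=> bX bY XY; apply: l2form_unique => e /(l2form_lim xi (amplify Y eta))[N hN].
exists N => n /hN; suff -> : partial_form 0 n (amplify X xi) eta =
  partial_form 0 n xi (amplify Y eta) by [].
by apply: eq_bigr => i _; rewrite !amplifyE.
Qed.

Lemma amplify_single X n v : bounded_op X -> amplify X (single n v) = single n (X v).
Proof.
move=> bX; apply: l2_ext => m; rewrite amplifyE// !singleE; case: ifP => // _.
by case: bX => lX _; exact: lin0 lX.
Qed.

End Amplification.

(** * The density form of the bicommutant theorem *)

Section Density.
Variables (R : realType) (B : cstarAlgType R) (H : hilbertType R).
Variables (pi : B -> H -> H) (Omega : H).
Hypotheses (pib : forall b, bounded_op (pi b)) (pil : linear pi).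
Hypothesis piM : forall a b, pi (amul a b) = pi a \o pi b.
Hypothesis piS : forall a, adjoint (pi a) (pi (star a)).
Hypothesis cyclic : dense (range (fun b => pi b Omega)).

Let lP := @l2form_positive R H.
Let iP := @inner_form R H.

(** Such an [x] is orthogonal to the dense orbit of [Omega]. This stands in for [pi 1 = id] when
    there is no unit. *)
Lemma nondegenerate x : (forall c, pi c x = 0) -> x = 0.
Proof.
move=> h; have x0 b : inner x (pi b Omega) = 0.
  rewrite (formC iP) piS h (form0r iP) rmorph0 //.
apply: (@hsq_le0_eps _ _ _ 1) => // e e0.
have [b hb] := dense_approx x cyclic e0.
have := hsq_ge0 (pi b Omega); move: hb.
rewrite /hsq (nsqB iP) x0 /= -/(hsq x); lra.
Qed.

Section Projection.
Variable xi : l2 H.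

Let eta b : l2 H := amplify (pi b) xi.
Let cl (v : l2 H) := forall e : R, 0 < e -> exists b, nsq (@l2form R H) (v - eta b) <= e.

Let eta_lin : linear eta.
Proof.
move=> a b c; apply: l2_ext => n; rewrite l2val_lin !amplifyE//.
by rewrite pil.
Qed.

Let eta_mul c b : amplify (pi c) (eta b) = eta (amul c b).
Proof. by apply: l2_ext => n; rewrite !amplifyE// piM. Qed.

Let cl_lin a v w : cl v -> cl w -> cl (a *: v + w).
Proof.
move=> cv cw e e0; pose K := 2 * sqmod a + 2.
have K0 : 0 < K by rewrite ltr_wpDl// mulr_ge0// sqmod_ge0.
have [b hb] := cv (e / K) (divr_gt0 e0 K0).
have [c hc] := cw (e / K) (divr_gt0 e0 K0).
exists (a *: b + c); rewrite eta_lin opprD addrACA -scalerBr.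
apply: le_trans (nsqD_le lP _ _) _; rewrite (nsqZ lP).
have -> : e = 2 * (sqmod a * (e / K)) + 2 * (e / K).
  by rewrite mulrA -mulrDl mulrC divfK ?gt_eqF.
by rewrite lerD// ler_pM2l// ler_wpM2l// sqmod_ge0.
Qed.

Let cl_eta b : cl (eta b).
Proof. by move=> e e0; exists b; rewrite subrr (nsq0 lP) ltW. Qed.

Let cl_amp c v : cl v -> cl (amplify (pi c) v).
Proof.
have /bounded_opP[K hK] := pib c; move=> cv e e0.
have K0 : 0 <= K by case: hK.
have K1 : 0 < K + 1 by rewrite ltr_wpDl.
have [b hb] := cv (e / (K + 1)) (divr_gt0 e0 K1).
exists (amul c b); rewrite -eta_mul -(linB (amplify_linear (pib c))).
apply: le_trans (amplify_bounded _ hK) _.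
apply: le_trans (ler_wpM2l K0 hb) _.
by rewrite mulrCA ger_pMr// ler_pdivrMr// mul1r lerDl.
Qed.

Let cl_uniq v : cl v -> (forall b, l2form (eta b) v = 0) -> v = 0.
Proof.
move=> cv v0; apply: l2_eq0; set c := nsq _ v.
have c0 : 0 <= c by exact: nsq_ge0 lP v.
suff : c ^+ 2 <= 0 by rewrite real_exprn_even_le0 ?num_real//= => /eqP.
apply: (@le0_eps _ _ c) => // e e0; have [b hb] := cv e e0.
have cE : c = complex.Re (l2form (v - eta b) v) by rewrite (formBl lP) v0 subr0.
rewrite {1}cE; apply: le_trans (Re_form_sqr_le lP _ _) _.
by rewrite mulrC ler_wpM2l.
Qed.

(** [E x] is the Riesz vector of [b |-> <eta b, x>], that is, the orthogonal projection of [x] to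
    the closed orbit of [xi]. It commutes with the amplified representation because the orbit is
    stable under [pi c] and under [pi (star c)]. *)
Lemma amplified_projection : exists E : l2 H -> l2 H,
  [/\ linear E, forall x, nsq (@l2form R H) (E x) <= nsq (@l2form R H) x,
      forall c x, E (amplify (pi c) x) = amplify (pi c) (E x),
      E xi = xi &
      forall x e, 0 < e -> exists b, nsq (@l2form R H) (E x - amplify (pi b) xi) <= e].
Proof.
have /choice[E hE] (x : l2 H) : exists v, [/\ forall b, l2form (eta b) x = l2form (eta b) v,
    cl v & nsq (@l2form R H) v <= nsq (@l2form R H) x].
  have [||v [h1 h2 h3]] := @Riesz R _ _ lP _ eta (fun b => l2form (eta b) x)
      (nsq (@l2form R H) x) (@l2form_complete R H) eta_lin.
  - by move=> a b c; rewrite eta_lin (formDl lP) (formZl lP).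
  - by move=> b; have := nsq_ge0 lP (eta b - x); rewrite (nsqB lP); lra.
  - by exists v; split.
have Eu x v : cl v -> (forall b, l2form (eta b) x = l2form (eta b) v) -> E x = v.
  move=> cv xv; apply/eqP; rewrite -subr_eq0; apply/eqP; apply: cl_uniq.
    rewrite addrC -scaleN1r; apply: cl_lin => //; by case: (hE x).
  by move=> b; rewrite (formBr lP) -xv; case: (hE x) => -> _ _; rewrite subrr.
have El : linear E.
  move=> a x y; apply: Eu; first by apply: cl_lin; [case: (hE x)|case: (hE y)].
  move=> b; rewrite !(formDr lP) !(formZr lP).
  by case: (hE x) => -> _ _; case: (hE y) => -> _ _.
have Ec c x : E (amplify (pi c) x) = amplify (pi c) (E x).
  apply: Eu; first by apply: cl_amp; case: (hE x).
  have adj : adjoint (pi (star c)) (pi c) by move=> y z; rewrite piS starK.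
  move=> b; rewrite -!(amplify_adjoint _ _ (pib (star c)) (pib c) adj) !eta_mul.
  by have [h _ _] := hE x; exact: h.
exists E; split => //.
- by move=> x; case: (hE x).
(* Without a unit [xi] need not lie in its own orbit; but every [pi c] kills the coordinates of
   [xi - E xi], which therefore vanish by nondegeneracy. *)
- have Eeta b : E (eta b) = eta b by apply: Eu.
  apply/esym/eqP; rewrite -subr_eq0; apply/eqP; apply: l2_ext => n.
  apply: nondegenerate => c; rewrite -amplifyE// (linB (amplify_linear (pib c))).
  by rewrite -Ec -/(eta c) Eeta subrr.
- by move=> x; case: (hE x).
Qed.

End Projection.

(* The matrix entries of the projection [E] of l2(H) onto the closure of
   [{(pi b xi_n)_n}] commute with [range pi], hence with [X]; so [E] commutes with
   the amplification of [X], and it fixes [xi]. *)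
Lemma bicommutant_density X (xi : l2 H) (e : R) : bicommutant (range pi) X -> 0 < e ->
  exists b, nsq (@l2form R H) (amplify X xi - amplify (pi b) xi) <= e.
Proof.
move=> [bX cX] e0; have [E [El E1 Ec Exi Ecl]] := amplified_projection xi.
suff -> : amplify X xi = E (amplify X xi) by exact: Ecl.
have /bounded_opP[K XK] := bX; have K0 : 0 <= K by case: XK.
(* This commutator is bounded, so it suffices that it vanishes on sequences with one nonzero entry,
   whose finite sums are dense. *)
pose D x := amplify X (E x) - E (amplify X x).
have Dl : linear D.
  move=> a x y; rewrite /D El !(amplify_linear bX) El scalerBr opprD.
  by rewrite addrACA.
have DK x : nsq (@l2form R H) (D x) <= 4 * K * nsq (@l2form R H) x.
  have := nsqD_le lP (amplify X (E x)) (- E (amplify X x)); rewrite (nsqN lP).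
  have := amplify_bounded (E x) XK; have := amplify_bounded x XK.
  have := E1 (amplify X x); have := ler_wpM2l K0 (E1 x); rewrite -/(D x); lra.
have D0 n v : D (single n v) = 0.
  apply: l2_ext => m; rewrite /D amplify_single//.
  pose Emn w := E (single n w) m.
  have sl : linear (@single R H n).
    move=> a x y; apply: l2_ext => k; rewrite l2val_lin !singleE.
    by case: ifP => // _; rewrite scaler0 addr0.
  have bE : bounded_op Emn.
    apply/bounded_opP; exists 1; split=> //.
      by move=> a x y; rewrite /Emn sl El l2val_lin.
    move=> w; rewrite mul1r; apply: le_trans (l2_coord_le _ m) _.
    apply: le_trans (E1 _) _; apply: l2_nsq_le => N.
    have [nN|Nn] := ltnP n N.
      rewrite big_mkord (bigD1 (Ordinal nN)) //= singleE eqxx big1 ?addr0// => i.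
      by rewrite -val_eqE /= singleE => /negPf ->; rewrite /hsq (nsq0 iP).
    rewrite big_nat big1 ?hsq_ge0// => i /andP[_ iN].
    by rewrite singleE ltn_eqF ?(leq_trans iN)// /hsq (nsq0 iP).
  have cE : commutant (range pi) Emn.
    split=> // _ [c _ <-]; apply/funext => w /=.
    by rewrite /Emn -(amplify_single n w (pib c)) Ec amplifyE.
  have /(congr1 (fun f => f v)) /= := cX _ cE; rewrite {1}/Emn => Xv.
  transitivity (amplify X (E (single n v)) m - E (single n (X v)) m) => //.
  by rewrite amplifyE// Xv subrr.
have Dx x : D x = 0.
  apply: l2_eq0; apply/eqP; rewrite eq_le nsq_ge0// andbT.
  apply: (@le0_eps _ _ (4 * K)); first by rewrite mulr_ge0.
  move=> d d0; have [N hN] := l2_trunc_cvg x d0.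
  have -> : D x = D (x - \sum_(0 <= n < N) single n (x n)).
    by rewrite (linB Dl) (lin_sum Dl) big1 ?subr0// => i _.
  by apply: le_trans (DK _) _; rewrite ler_wpM2l// mulr_ge0.
by have := Dx xi; rewrite /D Exi => /eqP; rewrite subr_eq0 => /eqP.
Qed.

End Density.

(** * Normal endomorphisms and the support projection *)

Section Normality.
Variables (R : realType) (B : cstarAlgType R) (H : hilbertType R).
Variables (pi : B -> H -> H) (Omega : H).
Hypotheses (pib : forall b, bounded_op (pi b)) (pil : linear pi).
Hypothesis piM : forall a b, pi (amul a b) = pi a \o pi b.
Hypothesis piS : forall a, adjoint (pi a) (pi (star a)).
Hypothesis cyclic : dense (range (fun b => pi b Omega)).

Implicit Types (v w : H) (X : H -> H) (L : (H -> H) -> H -> H).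

Let lP := @l2form_positive R H.
Let iP := @inner_form R H.

Lemma range_bicommutant b : bicommutant (range pi) (pi b).
Proof. by apply: sub_bicommutant; [move=> _ [c _ <-] | exists b]. Qed.

Lemma sum_interleave (T : Type) (f : T -> R) (u v : nat -> T) N :
  \sum_(0 <= n < N.*2) f (if odd n then v n./2 else u n./2) =
  \sum_(0 <= n < N) f (u n) + \sum_(0 <= n < N) f (v n).
Proof.
elim: N => [|N ih]; first by rewrite !big_geq// addr0.
rewrite doubleS !big_nat_recr//= ih odd_double /= uphalf_double doubleK.
by rewrite addrACA addrA.
Qed.

(** Interleaving two sequences gives a single one that controls both, which makes the sets in
    [approximants] stable under intersection. *)
Lemma l2_interleave (xi zeta : l2 H) : exists z : l2 H, forall X Y,
  bounded_op X -> bounded_op Y ->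
  nsq (@l2form R H) (amplify X xi - amplify Y xi) <=
    nsq (@l2form R H) (amplify X z - amplify Y z) /\
  nsq (@l2form R H) (amplify X zeta - amplify Y zeta) <=
    nsq (@l2form R H) (amplify X z - amplify Y z).
Proof.
pose u n := if odd n then zeta n./2 else xi n./2.
have ul2 : u \in @l2_pred R H.
  have [C hC] := l2valP xi; have [D hD] := l2valP zeta.
  apply/l2P; exists (C + D) => N.
  apply: le_trans (_ : \sum_(0 <= n < N.*2) hsq (u n) <= _).
    rewrite [leRHS](big_cat_nat (leq0n N))/= -?addnn ?leq_addr// lerDl.
    by apply: sumr_ge0 => i _; exact: hsq_ge0.
  by rewrite (sum_interleave (@hsq R H) xi zeta) lerD.
exists (L2 ul2) => X Y bX bY.
have dE (x : l2 H) n : hsq ((amplify X x - amplify Y x) n) = hsq (X (x n) - Y (x n)).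
  by rewrite -(amplifyE x n bX) -(amplifyE x n bY).
have s0 (x : nat -> H) (N : nat) : 0 <= \sum_(0 <= n < N) hsq (X (x n) - Y (x n)).
  by apply: sumr_ge0 => i _; exact: hsq_ge0.
have le2 N : \sum_(0 <= n < N) hsq (X (xi n) - Y (xi n)) +
    \sum_(0 <= n < N) hsq (X (zeta n) - Y (zeta n)) <=
    nsq (@l2form R H) (amplify X (L2 ul2) - amplify Y (L2 ul2)).
  rewrite -(sum_interleave (fun x => hsq (X x - Y x)) xi zeta).
  apply: le_trans (l2_partial_le _ N.*2); rewrite le_eqVlt; apply/orP; left; apply/eqP.
  by apply: eq_bigr => i _; rewrite dE.
by split; apply: l2_nsq_le => N; under eq_bigr do rewrite dE;
  have := le2 N; have := s0 xi N; have := s0 zeta N; lra.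
Qed.

(* Elements of [range pi] approximating [X] in the sigma-strong topology. *)
Definition approximants X : set_system (H -> H) :=
  [set S | exists (xi : l2 H) (e : R), 0 < e /\
    forall b, nsq (@l2form R H) (amplify X xi - amplify (pi b) xi) <= e -> S (pi b)].

Lemma approximants_proper X : bicommutant (range pi) X -> ProperFilter (approximants X).
Proof.
move=> MX; have bX : bounded_op X by case: MX.
apply: Build_ProperFilter_ex.
  move=> S [xi [e [e0 hS]]].
  have [b hb] := bicommutant_density pib pil piM piS cyclic xi MX e0.
  by exists (pi b); exact: hS.
split.
- by exists 0, 1.
- move=> S T [xi [e [e0 hS]]] [zeta [d [d0 hT]]].
  have [z hz] := l2_interleave xi zeta.
  exists z, (Num.min e d); split; first by rewrite lt_min e0.
  move=> b; rewrite le_min => /andP[be bd]; have [h1 h2] := hz _ _ bX (pib b).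
  by split; [apply: hS; exact: le_trans be | apply: hT; exact: le_trans bd].
- by move=> S T ST [xi [e [e0 hS]]]; exists xi, e; split=> // b /hS /ST.
Qed.

Lemma square_summable_l2 (xi : nat -> H) : square_summable xi -> xi \in @l2_pred R H.
Proof.
move=> /cvg_ex[l /series_cvgE hl]; have [N hN] := hl 1 ltr01.
have sE n : \sum_(0 <= k < n) `|xi k| ^+ 2 = (\sum_(0 <= k < n) hsq (xi k))%:C.
  by rewrite rmorph_sum; apply: eq_bigr => i _; rewrite -inner_norm nsqE.
apply/l2P; exists (nm l + 1) => n.
apply: le_trans (_ : \sum_(0 <= k < maxn N n) hsq (xi k) <= _).
  rewrite [leRHS](big_cat_nat (leq0n n))/= ?leq_maxr// lerDl.
  by apply: sumr_ge0 => i _; exact: hsq_ge0.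
have := hN (maxn N n) (leq_maxl _ _); rewrite sE => h1.
have := le_trans (Re_le_nm _) h1; rewrite ReB /=.
by have := Re_le_nm l; lra.
Qed.

Lemma sigma_weak_functionalE X (xi eta : l2 H) : bounded_op X ->
  sigma_weak_functional xi eta X = l2form (amplify X xi) eta.
Proof.
move=> bX; rewrite /l2form /sigma_weak_functional; congr (limn (series _)).
by apply/funext => n; rewrite amplifyE.
Qed.

Lemma approximants_cvg X : bicommutant (range pi) X -> sigma_weak_cvg (approximants X) X.
Proof.
move=> MX xi0 eta0 /square_summable_l2 h1 /square_summable_l2 h2.
have bX : bounded_op X by case: MX.
pose xi := L2 h1; pose eta := L2 h2; pose K := nsq (@l2form R H) eta.
have K0 : 0 <= K by exact: nsq_ge0 lP eta.
have K1 : 0 < K + 1 by rewrite ltr_wpDl.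
have FF := approximants_proper MX.
apply/cvgrPdist_le => e e0.
have e'0 : 0 < complex.Re e by rewrite -rC_gt0 -(ge0_ReE (ltW e0)).
pose d := complex.Re e ^+ 2 / (K + 1).
have d0 : 0 < d by rewrite divr_gt0// exprn_gt0.
exists xi, d; split=> // b hb /=.
rewrite (sigma_weak_functionalE xi eta bX) (sigma_weak_functionalE xi eta (pib b)).
rewrite nmE [e in _ <= e](ge0_ReE (ltW e0)) lecR.
rewrite -(ler_pXn2r (n := 2)) ?nnegrE ?nm_ge0 ?(ltW e'0)// nm_sqmod -(formBl lP).
apply: le_trans (Cauchy_Schwarz lP _ _) _; rewrite -/K.
apply: le_trans (ler_wpM2r K0 hb) _.
by rewrite mulrAC ler_pdivrMr// ler_wpM2l ?sqr_ge0// lerDl.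
Qed.

Lemma l2form_single v w : l2form (single 0 v) (single 0 w) = inner v w :> R[i].
Proof.
apply: l2form_unique => e e0; exists 1%N => -[//|n] _.
rewrite /partial_form big_nat_recl// !singleE /= big1 ?addr0 ?subrr ?nm0 ?ltW//.
by move=> i _; rewrite !singleE (form0l iP).
Qed.

Lemma square_summable_single v : square_summable (single 0 v : l2 H).
Proof.
apply/cvg_ex; exists (l2form (single 0 v) (single 0 v)).
have := @l2form_cvg R H (single 0 v) (single 0 v).
by under eq_fun do rewrite inner_norm.
Qed.

Lemma vector_stateE X v : bounded_op X ->
  vector_state v X = sigma_weak_functional (single 0 v : l2 H) (single 0 v : l2 H) X.
Proof. by move=> bX; rewrite sigma_weak_functionalE// amplify_single// l2form_single. Qed.

(** Along [approximants X] the values before and after [L] converge sigma-weakly, the latter by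
    normality, and they agree on [range pi]; uniqueness of limits transfers the equality to [X]. *)
Lemma normal_endomorphism_vector_state L v :
  normal_endomorphism (bicommutant (range pi)) L ->
  (forall b, vector_state v (L (pi b)) = vector_state v (pi b)) ->
  forall X, bicommutant (range pi) X -> vector_state v (L X) = vector_state v X.
Proof.
move=> [LM _ _ _ Ln] Lpi X MX.
have bM Y : bicommutant (range pi) Y -> bounded_op Y by case.
have FF := approximants_proper MX.
have FM : approximants X (bicommutant (range pi)).
  by exists 0, 1; split=> // b _; exact: range_bicommutant.
have s0 := @square_summable_single v.
have c1 := approximants_cvg MX s0 s0.
have c2 := Ln _ _ FF FM MX (approximants_cvg MX) _ _ s0 s0.
rewrite !vector_stateE//; [|exact: bM|exact/bM/LM].
have FL : ProperFilter (L @ approximants X) by apply: fmap_proper_filter.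
have hd : hausdorff_space R[i]^o by exact: norm_hausdorff.
have u := @cvg_unique _ hd _ (@fmap_proper_filter _ _
  (sigma_weak_functional (single 0 v : l2 H) (single 0 v : l2 H)) _ FL).
apply: u; first exact: c2.
pose f := sigma_weak_functional (single 0 v : l2 H) (single 0 v : l2 H).
apply: cvg_trans; last exact: c1.
apply: (@near_eq_cvg _ _ (approximants X) _ f (f \o L)).
exists 0, 1; split=> // b _ /=.
have bL := bM _ (LM _ (range_bicommutant b)).
by rewrite /f -(vector_stateE v bL) -(vector_stateE v (pib b)) Lpi.
Qed.

(** [L P] is a projection in the bicommutant on which the vector state is still 1, so minimality of
    [P] applies; the second identity is the adjoint of the first. *)
Lemma support_projection_endomorphism L P :
  normal_endomorphism (bicommutant (range pi)) L ->
  (forall b, vector_state Omega (L (pi b)) = vector_state Omega (pi b)) ->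
  support_projection (bicommutant (range pi)) Omega P ->
  L P \o P = P /\ P \o L P = P.
Proof.
move=> LP Lpi [MP [bP PP PS] P1 Pmin].
have [LM _ LMul LS _] := LP.
have LPP : L P \o P = P.
  apply: Pmin; first exact: LM.
    by split; [case: (LM _ MP) | rewrite -LMul// PP | exact: LS].
  by rewrite (normal_endomorphism_vector_state LP Lpi MP).
split=> //; apply/funext => x; apply: inner_ext => y.
have LPS : adjoint (L P) (L P) by exact: LS.
by rewrite /= PS LPS; have /(congr1 (fun f => f y)) /= -> := LPP; rewrite -PS.
Qed.

End Normality.
(** * States and the reduced dynamics *)

Section States.
Variables (R : realType) (A : cstarAlgType R).
Implicit Types (phi : A -> R[i]) (D : set A).

Lemma state_nm phi a : state phi -> nm (phi a) <= nm a.
Proof. by move=> [_ _ + _] => /(_ a); rewrite !nmE lecR. Qed.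

Lemma state_min_norm phi (c : R) : state phi -> 0 <= c ->
  (forall a, nm (phi a) <= c * nm a) -> 1 <= c.
Proof.
move=> [_ _ _ h] c0 hc; rewrite -lecR rmorph1; apply: h; first by rewrite ler0c.
by move=> a; rewrite !nmE -rmorphM lecR.
Qed.

(** The ratio is read off at some [star x0 x0], where both values are nonnegative and [Kadison]
    makes that of [phi] positive. Since both functionals have norm 1, the ratio and its inverse are
    at least 1. *)
Lemma proportional_states phi1 phi : state phi1 -> state phi ->
  (forall x y, phi1 x * phi y = phi1 y * phi x) -> phi1 =1 phi.
Proof.
move=> s1 s prop; have [l1 p1 _ _] := s1; have [l p b _] := s.
have [x0 x0P] : exists x, phi x != 0.
  apply: contrapT => h.
  have z x : phi x = 0 by apply/eqP/negPn/negP => px; apply: h; exists x.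
  have : (1 : R) <= 0 by apply: (state_min_norm s) => // a; rewrite z nm0 mul0r.
  by rewrite ler10.
pose y := amul (star x0) x0; pose r := complex.Re (phi y); pose r1 := complex.Re (phi1 y).
have yE : phi y = r%:C by exact/ge0_ReE/p.
have y1E : phi1 y = r1%:C by exact/ge0_ReE/p1.
have r10 : 0 <= r1 by exact/ge0_Re/p1.
have r0 : 0 < r.
  apply: lt_le_trans (Kadison x0 l p (fun a => state_nm a s)).
  by rewrite lt_neqAle sqmod_ge0 andbT eq_sym; apply: contra x0P => /eqP/sqmod_eq0 ->.
pose k := r1 / r; have k0 : 0 <= k by rewrite divr_ge0// ltW.
have E x : phi1 x = k%:C * phi x.
  have rn0 : r%:C != 0 :> R[i] by rewrite gt_eqF// rC_gt0.
  apply: (mulIf rn0); rewrite -yE prop y1E /k rmorphM fmorphV yE.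
  by rewrite mulrAC divfK.
have k1 : 1 <= k.
  apply: (state_min_norm s1) => // a.
  by rewrite E nmM nmR ger0_norm// ler_wpM2l// state_nm.
have kp : 0 < k by exact: lt_le_trans k1.
have k1' : 1 <= k^-1.
  apply: (state_min_norm s); first by rewrite invr_ge0.
  move=> a; rewrite -(ler_pM2l kp) mulrA divff ?gt_eqF// mul1r.
  have := state_nm a s1; by rewrite E nmM nmR ger0_norm.
have kE : k = 1.
  by apply/eqP; rewrite eq_le k1 andbT -invf_ge1.
by move=> x; rewrite E kE rmorph1 mul1r.
Qed.

Lemma dense_nm D (x : A) (e : R) : dense D -> 0 < e -> exists2 y, D y & nm (x - y) <= e.
Proof.
move=> dD e0; have [||y [bx Dy]] := dD (ball x e%:C).
- by exists x; apply: ballxx; rewrite rC_gt0.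
- by apply: ball_open; rewrite rC_gt0.
by exists y => //; move: bx; rewrite -ball_normE /= nmE ltcR => /ltW.
Qed.

(** Write [x] as nearly [amul y x] with [y] from an approximate unit, then approximate [star y] and
    [x] within [D]. The three errors are at most [e], [e] and [2 * e], whence the factor 4. *)
Lemma products_dense D (G : A -> R[i]) (K : R) : dense D -> scalar G -> 0 <= K ->
  (forall x, nm (G x) <= K * nm x) ->
  (forall a b, D a -> D b -> G (amul (star a) b) = 0) -> forall x, G x = 0.
Proof.
move=> dD lG K0 GK G0 x; apply: (@nm_le_eps _ _ (G x : R[i]^o) (K * 4)).
  by rewrite mulr_ge0.
move=> e e0; have [r [g [/= _ y1 yx]]] := approximate_unit x e0.
set y := _ *: _ in y1 yx.
have nx0 := nm_ge0 x; have nx : 0 < nm x + 1 by rewrite ltr_wpDl.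
pose d := Num.min 1 (e / (nm x + 1)).
have d0 : 0 < d by rewrite lt_min ltr01 divr_gt0.
have [a Da ha] := dense_nm (star y) dD d0.
have [b Db hb] := dense_nm x dD e0.
have d1 : d <= 1 by rewrite ge_min lexx.
have de : d * nm x <= e.
  apply: le_trans (_ : e / (nm x + 1) * nm x <= _).
    by rewrite ler_wpM2r// ge_min lexx orbT.
  by rewrite mulrAC ler_pdivrMr// ler_wpM2l ?(ltW e0)// lerDl.
have a2 : nm a <= 2.
  have := nmB (star y) (star y - a); rewrite opprB addrC subrK nm_star; lra.
have -> : G x = G (x - amul (star a) b) by rewrite (scalB lG) G0// subr0.
apply: le_trans (GK _) _; rewrite -mulrA ler_wpM2l//.
have -> : x - amul (star a) b = (x - amul y x) +
    (amul (star (star y - a)) x + amul (star a) (x - b)).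
  by rewrite starB starK amulBl amulBr subrKA subrKA.
have n1 : nm (amul (star (star y - a)) x) <= e.
  apply: le_trans (nm_amul _ _) _; rewrite nm_star.
  by apply: le_trans de; rewrite ler_wpM2r.
have n2 : nm (amul (star a) (x - b)) <= 2 * e.
  apply: le_trans (nm_amul _ _) _; rewrite nm_star.
  by rewrite ler_pM ?nm_ge0.
have := nmD (x - amul y x) (amul (star (star y - a)) x + amul (star a) (x - b)).
have := nmD (amul (star (star y - a)) x) (amul (star a) (x - b)); lra.
Qed.

End States.

(** * The GNS representation and Radon-Nikodym derivatives *)

Section GNS.
Variables (R : realType) (B : cstarAlgType R) (psi : B -> R[i]).
Variables (H : hilbertType R) (pi : B -> H -> H) (Omega : H).
Hypothesis gns : gns_representation psi pi Omega.

Let iP := @inner_form R H.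
Let pib b : bounded_op (pi b). Proof. by case: gns => -[]. Qed.
Let pil : linear pi. Proof. by case: gns => -[]. Qed.
Let piM a b : pi (amul a b) = pi a \o pi b. Proof. by case: gns => _ + _ _ _; exact. Qed.
Let piS a : adjoint (pi a) (pi (star a)). Proof. by case: gns => _ _ + _ _; exact. Qed.
Let psiE b : psi b = inner (pi b Omega) Omega. Proof. by case: gns => _ _ _ + _; exact. Qed.
Let cyclic : dense (range (fun b => pi b Omega)). Proof. by case: gns. Qed.

Lemma gns_inner a b : inner (pi a Omega) (pi b Omega) = psi (amul (star b) a).
Proof. by rewrite psiE piM /= (piS (star b)) starK. Qed.

Lemma gns_hsq b : hsq (pi b Omega) = complex.Re (psi (amul (star b) b)).
Proof. by rewrite -gns_inner. Qed.

(** For [b] with [pi b Omega] near [Omega], put x = Re <pi b Omega, Omega>. [Kadison] gives x^2 <=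
    |pi b Omega|^2, so |Omega|^2 is at most 2 x - x^2 <= 1 up to the error. *)
Lemma gns_vector_norm : state psi -> hsq Omega <= 1.
Proof.
move=> sp; have [l p _ _] := sp; apply: le_eps => e e0.
have [b hb] := dense_approx Omega cyclic e0.
have := Kadison b l p (fun a => state_nm a sp); rewrite -gns_hsq psiE => hK.
have := le_trans (Re_le_sqmod _) hK; move: hb.
rewrite /hsq (nsqB iP) (formC iP (pi b Omega)) Re_conj.
set x := complex.Re _; have := sqr_ge0 (x - 1); nra.
Qed.

Lemma cyclic_ext x y : (forall a, inner (pi a Omega) x = inner (pi a Omega) y) -> x = y.
Proof.
move=> h; apply/eqP; rewrite -subr_eq0; apply/eqP.
have z0 a : inner (pi a Omega) (x - y) = 0 by rewrite (formBr iP) h subrr.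
apply: (@hsq_le0_eps _ _ _ 1) => // e e0.
have [b hb] := dense_approx (x - y) cyclic e0.
have := hsq_ge0 (pi b Omega); move: hb.
rewrite /hsq (nsqB iP) (formC iP) z0 rmorph0 /= mulr0; lra.
Qed.

(* The Radon-Nikodym derivative in the commutant of a functional dominated by [psi]. *)
Lemma Radon_Nikodym (g : B -> R[i]) : scalar g ->
  (forall b, 0 <= g (amul (star b) b)) ->
  (forall b, complex.Re (g (amul (star b) b)) <= complex.Re (psi (amul (star b) b))) ->
  exists S, [/\ commutant (range pi) S, forall x, hsq (S x) <= hsq x &
    forall a b, g (amul (star a) b) = inner (pi b Omega) (S (pi a Omega))].
Proof.
move=> lg g0 gpsi; have qP := functional_form_positive lg g0.
have etal : linear (fun b => pi b Omega) by move=> c a b; rewrite pil.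
(* Indexing [t] by [b] instead of [pi b Omega] avoids a well-definedness argument on the orbit. *)
have /choice[t ht] b : exists v, (forall a, g (amul (star b) a) = inner (pi a Omega) v) /\
    hsq v <= hsq (pi b Omega).
  have [||v [h1 _ h2]] := @Riesz R _ _ iP _ (fun b => pi b Omega)
      (fun a => g (amul (star b) a)) (hsq (pi b Omega)) (@inner_complete R H) etal.
  - by move=> c x y; rewrite amulDr amulZr lg.
  - move=> a; rewrite -/(hsq (pi a Omega)) !gns_hsq.
    have := gpsi a; have := gpsi b; have := nsq_ge0 qP (a - b).
    rewrite (nsqB qP) /nsq /functional_form; lra.
  - by exists v.
have tE b a : inner (pi a Omega) (t b) = g (amul (star b) a) by case: (ht b) => ->.
have tn b : hsq (t b) <= hsq (pi b Omega) by case: (ht b).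
have tl : linear t.
  move=> c a b; apply: cyclic_ext => d.
  rewrite (formDr iP) (formZr iP) !tE star_antilinear amulDl amulZl.
  by rewrite (scalD lg) (scalZ lg).
have tpi c b : t (amul c b) = pi c (t b).
  apply: cyclic_ext => a; rewrite tE starM -(starK c) -piS starK.
  have -> : pi (star c) (pi a Omega) = pi (amul (star c) a) Omega by rewrite piM.
  by rewrite tE amulA.
(* [S] is the adjoint of the map taking [pi b Omega] to [t b]; a second use of [Riesz] defines it on
   all of [H] at once. *)
have /choice[S hS] x : exists v, (forall b, inner (t b) x = inner (pi b Omega) v) /\
    hsq v <= hsq x.
  have [||v [h1 _ h2]] := @Riesz R _ _ iP _ (fun b => pi b Omega)
      (fun b => inner (t b) x) (hsq x) (@inner_complete R H) etal.
  - by move=> c a b; rewrite tl (formDl iP) (formZl iP).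
  - move=> b; have := tn b; have := nsq_ge0 iP (t b - x).
    by rewrite (nsqB iP) -!/(hsq _); lra.
  - by exists v.
have SE b x : inner (pi b Omega) (S x) = inner (t b) x by case: (hS x) => ->.
have Sn x : hsq (S x) <= hsq x by case: (hS x).
have Sl : linear S.
  move=> c x y; apply: cyclic_ext => b.
  by rewrite (formDr iP) (formZr iP) !SE (formDr iP) (formZr iP).
exists S; split => //.
  split; first by apply/bounded_opP; exists 1; split=> // x; rewrite mul1r.
  move=> _ [c _ <-]; apply/funext => x; apply: cyclic_ext => b /=.
  rewrite SE -{1}(starK c) -piS -tpi.
  rewrite -[in RHS](starK c) -piS.
  have -> : pi (star c) (pi b Omega) = pi (amul (star c) b) Omega by rewrite piM.
  by rewrite SE.
by move=> a b; rewrite SE (formC iP) tE; exact: (formC qP).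
Qed.

End GNS.
(** Since |P Omega|^2 = <P Omega, Omega> = 1 and |Omega| <= 1, expanding |P Omega - Omega|^2 gives
    at most 0. *)
Lemma support_projection_vector (R : realType) (H : hilbertType R)
    (M : set (H -> H)) (Omega : H) (P : H -> H) :
  hsq Omega <= 1 -> support_projection M Omega P -> P Omega = Omega.
Proof.
move=> O1 [_ [_ PP PS] P1 _]; have iP := @inner_form R H.
have PO : hsq (P Omega) = 1.
  rewrite /hsq /nsq PS -[P (P _)]/((P \o P) _) PP -PS.
  by rewrite -[inner _ _]/(vector_state Omega P) P1.
apply/eqP; rewrite -subr_eq0; apply/eqP/hsq_eq0/eqP; rewrite eq_le hsq_ge0 andbT.
move: PO; rewrite /hsq (nsqB iP) => ->.
by rewrite -[inner (P _) _]/(vector_state Omega P) P1 /=; move: O1; rewrite /hsq; lra.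
Qed.

(** * From mixing of the reduced semigroup to proportional functionals *)

Section ReducedDynamics.
Variables (R : realType) (T : realDomainType).
Variables (B0 : cstarAlgType R) (lam : T -> B0 -> B0) (psi : B0 -> R[i]).
Variables (H : hilbertType R) (pi0 : B0 -> H -> H) (Omega : H).
Variables (Lam : T -> (H -> H) -> (H -> H)) (P : H -> H).
Hypotheses (psiS : state psi)
  (psi_lam : forall t, 0 <= t -> forall b, psi (lam t b) = psi b)
  (lamP : injective_endomorphism_semigroup lam)
  (gns : gns_representation psi pi0 Omega)
  (LamP : forall t, 0 <= t -> normal_endomorphism (bicommutant (range pi0)) (Lam t) /\
     forall b, Lam t (pi0 b) = pi0 (lam t b))
  (suppP : support_projection (bicommutant (range pi0)) Omega P).

Let iP := @inner_form R H.
Let pib b : bounded_op (pi0 b). Proof. by case: gns => -[]. Qed.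
Let pil : linear pi0. Proof. by case: gns => -[]. Qed.
Let piM a b : pi0 (amul a b) = pi0 a \o pi0 b. Proof. by case: gns => _ + _ _ _; exact. Qed.
Let piS a : adjoint (pi0 a) (pi0 (star a)). Proof. by case: gns => _ _ + _ _; exact. Qed.
Let psiE b : psi b = inner (pi0 b Omega) Omega. Proof. by case: gns => _ _ _ + _; exact. Qed.
Let cyclic : dense (range (fun b => pi0 b Omega)). Proof. by case: gns. Qed.
Let PO : P Omega = Omega := support_projection_vector (gns_vector_norm gns psiS) suppP.
Let PP : P \o P = P. Proof. by case: suppP => _ []. Qed.
Let PPx x : P (P x) = P x. Proof. by rewrite -[LHS]/((P \o P) x) PP. Qed.
Let PS : adjoint P P. Proof. by case: suppP => _ []. Qed.

(** [Lam t] turns the inner factors [P] into [Lam t P], and the outer factors [P] absorb these. *)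
Lemma reduced_corner t b : 0 <= t ->
  reduced_map P (Lam t) (P \o pi0 b \o P) = P \o pi0 (lam t b) \o P.
Proof.
move=> t0; have [LP Lpi] := LamP t0; have [MP _ _ _] := suppP.
have [|LPP PLP] := support_projection_endomorphism pib pil piM piS cyclic LP _ suppP.
  by move=> b'; rewrite Lpi /vector_state -!psiE psi_lam.
have Mpi := range_bicommutant pib b.
have [_ _ LM _ _] := LP; rewrite /reduced_map.
have -> : P \o (P \o pi0 b \o P) \o P = P \o pi0 b \o P.
  by apply/funext => x /=; rewrite !PPx.
rewrite LM//; last exact: bicommutant_comp.
rewrite LM// Lpi; apply/funext => x /=.
have /(congr1 (fun f => f x)) /= -> := LPP.
by have /(congr1 (fun f => f (pi0 (lam t b) (P x)))) /= -> := PLP.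
Qed.

Lemma reduced_state_corner b : reduced_state Omega P (P \o pi0 b \o P) = psi b.
Proof.
rewrite /reduced_state /vector_state /= PO PO PS PO PS PO -psiE //.
Qed.

(** For [b = c] the right side is |P pi0 (lam t c) Omega|^2, the quantity that mixing controls. *)
Lemma reduced_state_correlation b c t : 0 <= t ->
  reduced_state Omega P (reduced_map P (Lam t) (P \o pi0 (star b) \o P) \o
     reduced_map P (Lam t) (P \o pi0 c \o P)) =
  inner (P (pi0 (lam t c) Omega)) (pi0 (lam t b) Omega).
Proof.
move=> t0; rewrite !reduced_corner// /reduced_state /vector_state /= !PO.
rewrite PS PO PS PO PPx.
have [+ _ _] := lamP => /(_ t t0)[[_ _ ->] _].
by rewrite (piS (star _)) starK.
Qed.

Hypothesis mixing : forall x y,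
  corner (bicommutant (range pi0)) P x -> corner (bicommutant (range pi0)) P y ->
  (reduced_state Omega P (reduced_map P (Lam t) x \o reduced_map P (Lam t) y) : R[i]^o)
    @[t --> time_infty T] --> (reduced_state Omega P x * reduced_state Omega P y : R[i]^o).

Lemma support_vector_cvg c (e : R) : 0 < e -> exists t0, forall t, t0 <= t -> 0 <= t ->
  hsq (P (pi0 (lam t c) Omega) - psi c *: Omega) <= e.
Proof.
move=> e0.
have Cx b : corner (bicommutant (range pi0)) P (P \o pi0 b \o P).
  by exists (pi0 b) => //; exact: range_bicommutant.
have e'0 : 0 < e%:C :> R[i] by rewrite rC_gt0.
have [t0 ht] := mixing (Cx (star c)) (Cx c) (nbhsx_ballx _ _ e'0).
exists t0 => t t0t tp; have := ht _ t0t.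
rewrite /= -ball_normE /= reduced_state_correlation// !reduced_state_corner.
have -> : psi (star c) = (psi c)^*.
  by rewrite !psiE piS starK (formC iP).
rewrite conj_mul nmE ltcR => /ltW h.
have O1 : hsq Omega <= 1 := gns_vector_norm gns psiS.
set x := pi0 (lam t c) Omega in h *.
(* As P Omega = Omega and [psi] is invariant, the cross term is -2 |psi c|^2; with |Omega| <= 1 the
   squared distance is at most <P x, x> - |psi c|^2. *)
rewrite /hsq (nsqB iP) (nsqZ iP) (formZr iP) PS PO -psiE psi_lam// conj_mul /=.
have -> : nsq (@inner R H) (P x) = complex.Re (inner (P x) x).
  by rewrite /nsq -PS PPx.
have := sqmod_ge0 (psi c); have := hsq_ge0 Omega; rewrite /hsq in O1 *.
have := Re_le_nm (inner (P x) x - (sqmod (psi c))%:C); rewrite nmBC ReB /=.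
nra.
Qed.

Variables (Binf : cstarAlgType R) (laminf : T -> Binf -> Binf).
Variables (i0 : B0 -> Binf) (psiinf : Binf -> R[i]).
Hypotheses (indlim : inductive_limit lam laminf i0) (psiinfS : state psiinf)
  (psiinf_lam : forall t a, psiinf (laminf t a) = psiinf a)
  (psiinf_i0 : forall b, psiinf (i0 b) = psi b).

(* [phi (i0 c)] is close to [psi c <Omega, S Omega>] for a Radon-Nikodym
   derivative [S] of [phi \o laminf (-t) \o i0] and [t] large. *)
Lemma dominated_proportional_i0 (phi : Binf -> R[i]) a1 b1 a2 b2 : scalar phi ->
  (forall a, 0 <= phi (amul (star a) a)) ->
  (forall a, complex.Re (phi (amul (star a) a)) <=
             complex.Re (psiinf (amul (star a) a))) ->
  let c1 := amul (star a1) b1 in let c2 := amul (star a2) b2 in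
  phi (i0 c1) * psi c2 = phi (i0 c2) * psi c1.
Proof.
move=> lphi phi0 phile c1 c2.
have [[laminf_hom laminf0 laminfD] [[i0l i0M i0S] _] i0lam _] := indlim.
apply/eqP; rewrite -subr_eq0; apply/eqP/sqmod_eq0/eqP; rewrite eq_le sqmod_ge0 andbT.
pose K := 2 * sqmod (psi c2) + 2 * sqmod (psi c1).
have K0 : 0 <= K by rewrite addr_ge0// mulr_ge0// sqmod_ge0.
apply: (le0_eps K0) => e e0.
have [t1 ht1] := support_vector_cvg c1 e0; have [t2 ht2] := support_vector_cvg c2 e0.
pose t := Num.max 0 (Num.max t1 t2).
have t0 : 0 <= t by rewrite le_max lexx.
have {}ht1 : hsq (P (pi0 (lam t c1) Omega) - psi c1 *: Omega) <= e.
  by apply: ht1 => //; rewrite !le_max lexx orbT.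
have {}ht2 : hsq (P (pi0 (lam t c2) Omega) - psi c2 *: Omega) <= e.
  by apply: ht2 => //; rewrite !le_max lexx !orbT.
have [hl hM hS] := laminf_hom (- t).
have [+ _ _] := lamP => /(_ t t0)[[_ lamM lamS] _].
(* Moving back by [t] lets [g] see [i0 c] at the late element [lam t c], while invariance of
   [psiinf] keeps [g] dominated by [psi]. *)
pose g b := phi (laminf (- t) (i0 b)).
have gE c : g (lam t c) = phi (i0 c).
  by rewrite /g -i0lam// -laminfD addrC subrr laminf0.
have gM a b : g (amul (star a) b) =
    phi (amul (star (laminf (- t) (i0 a))) (laminf (- t) (i0 b))).
  by rewrite /g i0M hM i0S hS.
have [|||S [[bS cS] Sn Sg]] := Radon_Nikodym gns (g := g).
- by move=> a x y; rewrite /g i0l hl lphi.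
- by move=> b; rewrite gM.
- move=> b; rewrite gM (le_trans (phile _))// -hS -hM psiinf_lam -i0S -i0M.
  by rewrite psiinf_i0.
have SP : S Omega = P (S Omega).
  have [[_ cP] _ _ _] := suppP.
  have /(congr1 (fun f => f Omega)) /= := cP _ (conj bS cS).
  by rewrite PO.
have phiE a b (c := amul (star a) b) :
    phi (i0 c) = inner (P (pi0 (lam t c) Omega)) (S Omega).
  rewrite -gE /c lamM lamS Sg PS -SP.
  have /(congr1 (fun f => f Omega)) /= -> := cS (pi0 (lam t a)) (ex_intro2 _ _ _ I erefl).
  by rewrite piM /= (piS (star _)) starK.
pose d c := inner (P (pi0 (lam t c) Omega) - psi c *: Omega) (S Omega).
have dE a b (c := amul (star a) b) : phi (i0 c) = psi c * inner Omega (S Omega) + d c.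
  by rewrite /d (formBl iP) (formZl iP) -phiE addrC subrK.
have dle c : hsq (P (pi0 (lam t c) Omega) - psi c *: Omega) <= e -> sqmod (d c) <= e.
  move=> hc; apply: le_trans (Cauchy_Schwarz iP _ _) _.
  have SO : hsq (S Omega) <= 1 by apply: le_trans (Sn _) (gns_vector_norm gns psiS).
  have := hsq_ge0 (P (pi0 (lam t c) Omega) - psi c *: Omega).
  by have := hsq_ge0 (S Omega); rewrite /hsq in SO hc *; nra.
(* The terms with <Omega, S Omega> cancel, leaving only the small errors [d]. *)
have -> : phi (i0 c1) * psi c2 - phi (i0 c2) * psi c1 = d c1 * psi c2 + - (d c2 * psi c1).
  by rewrite /c1 /c2 !dE -/c1 -/c2; ring.
apply: le_trans (sqmodD_le _ _) _.
have -> : sqmod (- (d c2 * psi c1)) = sqmod (d c2) * sqmod (psi c1).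
  by rewrite -sqmodM /sqmod; case: (_ * _) => x y /=; rewrite !sqrrN.
rewrite sqmodM /K.
have := dle _ ht1; have := dle _ ht2; have := sqmod_ge0 (psi c1); have := sqmod_ge0 (psi c2).
have := sqmod_ge0 (d c1); have := sqmod_ge0 (d c2); nra.
Qed.

(** Four elements of the union of the tail algebras lie in a single [laminf u (i0 B0)], because the
    tails decrease; composing [phi] with [laminf u] reduces to the case of [i0 B0]. *)
Lemma dominated_proportional (phi : Binf -> R[i]) (K : R) : scalar phi ->
  (forall a, 0 <= phi (amul (star a) a)) ->
  (forall a, complex.Re (phi (amul (star a) a)) <=
             complex.Re (psiinf (amul (star a) a))) ->
  0 <= K -> (forall a, nm (phi a) <= K * nm a) ->
  forall x y, phi x * psiinf y = phi y * psiinf x.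
Proof.
move=> lphi phi0 phile K0 phiK.
have [[laminf_hom laminf0 laminfD] [[i0l i0M i0S] _] i0lam dD] := indlim.
set D := \bigcup_(t in setT) _ in dD.
have [linf _ binf _] := psiinfS.
have prodD a1 b1 a2 b2 : D a1 -> D b1 -> D a2 -> D b2 ->
    phi (amul (star a1) b1) * psiinf (amul (star a2) b2) =
    phi (amul (star a2) b2) * psiinf (amul (star a1) b1).
  move=> [s1 _ h1] [s2 _ h2] [s3 _ h3] [s4 _ h4].
  pose u := Num.min (Num.min s1 s2) (Num.min s3 s4).
  have dec s x : u <= s -> tail_algebra i0 laminf s x -> exists b, x = laminf u (i0 b).
    move=> us hx; have [_ [b _ <-] <-] := tail_algebra_decreasing indlim us hx.
    by exists b.
  have [|a1' ->] := dec _ _ _ h1; first by rewrite !ge_min lexx.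
  have [|b1' ->] := dec _ _ _ h2; first by rewrite !ge_min lexx orbT.
  have [|a2' ->] := dec _ _ _ h3; first by rewrite !ge_min lexx !orbT.
  have [|b2' ->] := dec _ _ _ h4; first by rewrite !ge_min lexx !orbT.
  have [hl hM hS] := laminf_hom u.
  rewrite -!hS -!hM !psiinf_lam -!i0S -!i0M !psiinf_i0.
  apply: (@dominated_proportional_i0 (phi \o laminf u)) => /=.
  - by move=> a x y; rewrite /= hl lphi.
  - by move=> a; rewrite hM hS.
  - by move=> a; rewrite hM hS (le_trans (phile _))// -hS -hM psiinf_lam.
have bnd (p q : R[i]) x : nm (phi x * p - q * psiinf x) <= (K * nm p + nm q) * nm x.
  apply: le_trans (nmB _ _) _; rewrite !nmM mulrDl.
  apply: lerD; first by rewrite mulrAC ler_wpM2r ?nm_ge0.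
  by rewrite ler_wpM2l ?nm_ge0// state_nm.
have lin (p q : R[i]) : scalar (fun x => phi x * p - q * psiinf x).
  by move=> a x y; rewrite lphi linf; ring.
have K0' (p q : R[i]) : 0 <= K * nm p + nm q by rewrite addr_ge0 ?mulr_ge0 ?nm_ge0.
(* [products_dense] treats one linear functional, so the two arguments are freed one after the
   other. *)
have prod1 x a b : D a -> D b ->
    phi x * psiinf (amul (star a) b) = phi (amul (star a) b) * psiinf x.
  move=> Da Db; apply/eqP; rewrite -subr_eq0; apply/eqP; move: x.
  pose p := psiinf (amul (star a) b); pose q := phi (amul (star a) b).
  apply: (products_dense dD (lin p q) (K0' p q) (bnd p q)) => a' b' Da' Db'.
  by rewrite /p /q prodD// subrr.
move=> x y; apply/eqP; rewrite -subr_eq0; apply/eqP; move: x.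
pose p := psiinf y; pose q := phi y.
apply: (products_dense dD (lin p q) (K0' p q) (bnd p q)) => a b Da Db.
by rewrite /p /q -prod1// subrr.
Qed.

End ReducedDynamics.

Theorem corollary4p3 (R : realType) (k : time_kind)
    (B0 : cstarAlgType R) (lam : time R k -> B0 -> B0) (psi : B0 -> R[i])
    (Binf : cstarAlgType R) (laminf : time R k -> Binf -> Binf)
    (i0 : B0 -> Binf) (psiinf : Binf -> R[i])
    (H : hilbertType R) (pi0 : B0 -> H -> H) (Omega : H)
    (Lam : time R k -> (H -> H) -> (H -> H)) (P : H -> H) :
  let M := bicommutant (range pi0) in
  let A0 := corner M P in
  let tau t := reduced_map P (Lam t) in
  let psi0 := reduced_state Omega P in
  injective_endomorphism_semigroup lam ->
  state psi ->
  (forall t, 0 <= t -> forall b, psi (lam t b) = psi b) ->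
  inductive_limit lam laminf i0 ->
  state psiinf ->
  (forall t a, psiinf (laminf t a) = psiinf a) ->
  (forall b, psiinf (i0 b) = psi b) ->
  gns_representation psi pi0 Omega ->
  (forall t, 0 <= t -> normal_endomorphism M (Lam t) /\
                       forall b, Lam t (pi0 b) = pi0 (lam t b)) ->
  support_projection M Omega P ->
  (forall x y, A0 x -> A0 y ->
     (psi0 (tau t x \o tau t y) : R[i]^o) @[t --> time_infty (time R k)]
       --> (psi0 x * psi0 y : R[i]^o)) ->
  pure_state psiinf.
Proof.
move=> M A0 tau psi0 lamP psiS psi_lam indlim infS inf_lam inf_i0 gns LamP suppP mixing.
split=> // s phi1 phi2 /andP[s0 s1] st1 st2 conv.
(* Stated for an arbitrary pair of weights so as to serve both components. Domination by [psiinf]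
   holds for [r%:C * phi], and the nonzero factor is cancelled from the resulting
   proportionality. *)
have key (r r' : R) (phi phi' : Binf -> R[i]) : 0 < r -> 0 < r' ->
    state phi -> state phi' ->
    (forall a, psiinf a = r%:C * phi a + r'%:C * phi' a) -> phi =1 psiinf.
  move=> r0 r'0 sp sp' E; have [lp p0 _ _] := sp; have [_ p'0 _ _] := sp'.
  apply: proportional_states => // x y.
  have rn0 : r%:C != 0 :> R[i] by rewrite gt_eqF// rC_gt0.
  apply: (mulfI rn0); rewrite !mulrA.
  apply: (dominated_proportional psiS psi_lam lamP gns LamP suppP mixing indlim
    infS inf_lam inf_i0 (phi := fun a => r%:C * phi a) (K := r)) => //.
  - by move=> a u v; rewrite lp; ring.
  - by move=> a; rewrite mulr_ge0// ler0c ltW.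
  - move=> a; rewrite E ReD !ReZ lerDl.
    by apply: mulr_ge0; [exact: ltW | exact: ge0_Re].
  - exact: ltW.
  - by move=> a; rewrite nmM nmR gtr0_norm// ler_pM2l// state_nm.
split; first by apply: (key s (1 - s) phi1 phi2) => //; rewrite subr_gt0.
apply: (key (1 - s) s phi2 phi1) => //; first by rewrite subr_gt0.
by move=> a; rewrite conv addrC.
Qed.
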